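(* Let $n\ge 2$ and $p\geq 2$ be integers, and let $\mathcal{T}_1^p=\mathcal{T}^p(\mathbf{i}_{\mathbf{m}},\mathbf{i}_{\mathbf{k}},\mathbf{i}_{\mathbf{l}})$, with $\mathbf{i}_{\mathbf{m}},\mathbf{i}_{\mathbf{k}},\mathbf{i}_{\mathbf{l}}\in\mathbb{I}(n)$ pairwise distinct, be a principal 3D slice of the multicomplex Multibrot set $\mathcal{M}_n^p$. Then there exists a tricomplex principal 3D slice $\mathcal{T}_2^p=\mathcal{T}^p(\mathbf{i}_{\mathbf{r}},\mathbf{i}_{\mathbf{q}},\mathbf{i}_{\mathbf{s}})$, with $\mathbf{i}_{\mathbf{r}},\mathbf{i}_{\mathbf{q}},\mathbf{i}_{\mathbf{s}}\in\mathbb{I}(3)$ pairwise distinct, such that $\mathcal{T}_1^p\sim\mathcal{T}_2^p$ up to an affine transformation; that is, either $\mathcal{T}_1^p\sim\mathcal{T}_2^p$, or $\mathcal{T}_1^p\sim\mathcal{T}_3^p$ for some quadricomplex principal 3D slice $\mathcal{T}_3^p=\mathcal{T}^p(\mathbf{i}_{\mathbf{t}},\mathbf{i}_{\mathbf{u}},\mathbf{i}_{\mathbf{v}})$, with $\mathbf{i}_{\mathbf{t}},\mathbf{i}_{\mathbf{u}},\mathbf{i}_{\mathbf{v}}\in\mathbb{I}(4)$ pairwise distinct, which is the image of $\mathcal{T}_2^p$ under a bijective affine transformation $\mathbb{T}(\mathbf{i}_{\mathbf{r}},\mathbf{i}_{\mathbf{q}},\mathbf{i}_{\mathbf{s}})\to\mathbb{T}(\mathbf{i}_{\mathbf{t}},\mathbf{i}_{\mathbf{u}},\mathbf{i}_{\mathbf{v}})$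 of three-dimensional real vector spaces.
   Context: Multicomplex numbers: $\mathbb{M}(0)=\mathbb{R}$ and, for $n\geq1$, $\mathbb{M}(n)=\{\eta_1+\eta_2 i_n:\eta_1,\eta_2\in\mathbb{M}(n-1)\}$ with $i_n^2=-1$, with operations $(\eta_1+\eta_2 i_n)+(\zeta_1+\zeta_2 i_n)=(\eta_1+\zeta_1)+(\eta_2+\zeta_2)i_n$ and $(\eta_1+\eta_2 i_n)(\zeta_1+\zeta_2 i_n)=(\eta_1\zeta_1-\eta_2\zeta_2)+(\eta_1\zeta_2+\eta_2\zeta_1)i_n$. This is a commutative unital ring and a real vector space; $\mathbb{M}(n-1)\subset\mathbb{M}(n)$ via $\eta_2=0$. $\mathbb{I}(n)$ is the set of the $2^n$ products of distinct elements of $\{i_1,\dots,i_n\}$, including the empty product $1$; it is an $\mathbb{R}$-basis of $\mathbb{M}(n)$, each element squares to $\pm1$, and $\mathbb{I}(n)\subset\mathbb{I}(n+1)$. The norm on $\mathbb{M}(n)$ is the Euclidean norm of the coordinates in this basis. ''Tricomplex'' means $n=3$ and ''quadricomplex'' means $n=4$. For an integer $p\ge2$ and $c\in\mathbb{M}(n)$, $Q_{p,c}(\eta)=\eta^p+c$, and $Q_{p,c}^t$ is its $t$-th iterate. The Multibrot set is $\mathcal{M}_n^p=\{c\in\mathbb{M}(n):\{Q_{p,c}^t(0)\}_{t=1}^\infty\text{ is bounded}\}$. For pairwise distinct $\mathbf{i}_{\mathbf{m}},\mathbf{i}_{\mathbf{k}},\mathbf{i}_{\mathbf{l}}\in\mathbb{I}(n)$: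 $\mathbb{T}(\mathbf{i}_{\mathbf{m}},\mathbf{i}_{\mathbf{k}},\mathbf{i}_{\mathbf{l}})=\mathrm{span}_{\mathbb{R}}\{\mathbf{i}_{\mathbf{m}},\mathbf{i}_{\mathbf{k}},\mathbf{i}_{\mathbf{l}}\}$; the principal 3D slice is $\mathcal{T}^p(\mathbf{i}_{\mathbf{m}},\mathbf{i}_{\mathbf{k}},\mathbf{i}_{\mathbf{l}})=\{c\in\mathbb{T}(\mathbf{i}_{\mathbf{m}},\mathbf{i}_{\mathbf{k}},\mathbf{i}_{\mathbf{l}}):\{Q_{p,c}^t(0)\}_{t=1}^\infty\text{ is bounded}\}$; and $\mathrm{It}^p(\mathbf{i}_{\mathbf{m}},\mathbf{i}_{\mathbf{k}},\mathbf{i}_{\mathbf{l}})=\mathrm{span}_{\mathbb{R}}\{Q_{p,c}^t(0):c\in\mathbb{T}(\mathbf{i}_{\mathbf{m}},\mathbf{i}_{\mathbf{k}},\mathbf{i}_{\mathbf{l}}),\ t\in\{1,2,3,\dots\}\}$. Relation $\sim$: for two principal 3D slices $\mathcal{T}_1^p(\mathbf{i}_{\mathbf{m}},\mathbf{i}_{\mathbf{k}},\mathbf{i}_{\mathbf{l}})$ and $\mathcal{T}_2^p(\mathbf{i}_{\mathbf{r}},\mathbf{i}_{\mathbf{q}},\mathbf{i}_{\mathbf{s}})$ (each given with its triple of units), put $M_1=\mathrm{It}^p(\mathbf{i}_{\mathbf{m}},\mathbf{i}_{\mathbf{k}},\mathbf{i}_{\mathbf{l}})$ and $M_2=\mathrm{It}^p(\mathbf{i}_{\mathbf{r}},\mathbf{i}_{\mathbf{q}},\mathbf{i}_{\mathbf{s}})$.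 Then $\mathcal{T}_1^p\sim\mathcal{T}_2^p$ if there is an $\mathbb{R}$-linear bijection $\varphi:M_1\to M_2$ such that $\varphi(\mathbb{T}(\mathbf{i}_{\mathbf{m}},\mathbf{i}_{\mathbf{k}},\mathbf{i}_{\mathbf{l}}))=\mathbb{T}(\mathbf{i}_{\mathbf{r}},\mathbf{i}_{\mathbf{q}},\mathbf{i}_{\mathbf{s}})$ and, for all $c\in\mathbb{T}(\mathbf{i}_{\mathbf{m}},\mathbf{i}_{\mathbf{k}},\mathbf{i}_{\mathbf{l}})$ and all $\eta\in M_2$, $(\varphi\circ Q_{p,c}\circ\varphi^{-1})(\eta)=Q_{p,\varphi(c)}(\eta)$. Units belonging to different $\mathbb{I}(n)$ are compared inside $\mathbb{M}(N)$ for any $N$ large enough. *)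

(* Defs.v *)
From HB Require Import structures.
From mathcomp Require Import all_boot all_order all_algebra ring.
From mathcomp Require Import all_classical all_reals.

Set Implicit Arguments.
Unset Strict Implicit.
Unset Printing Implicit Defensive.
Import Order.TTheory GRing.Theory Num.Theory VectorInternalTheory.

Local Open Scope classical_set_scope.
Local Open Scope ring_scope.

#[short(type="comAlgVectType")]
HB.structure Definition ComAlgVect (R : nzRingType) :=
  {A of GRing.ComAlgebra R A & Vector R A}.

HB.instance Definition _ (R : comNzRingType) := Vector.on R^o.

(* AdjoinI x y stands for x + y i, where i ^+ 2 = -1. *)
Record adjoin_i (A : Type) : Type := AdjoinI { part1 : A; part2 : A }.

Section AdjoinI.
Variables (R : comNzRingType) (A : comAlgVectType R).
Local Notation Ai := (adjoin_i A).
Implicit Types (k : R) (u v w : Ai).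

Definition adjoin_i_pair u : A * A := (part1 u, part2 u).
Definition pair_adjoin_i (x : A * A) : Ai := AdjoinI x.1 x.2.
Fact adjoin_i_pairK : cancel adjoin_i_pair pair_adjoin_i. Proof. by case. Qed.
Fact pair_adjoin_iK : cancel pair_adjoin_i adjoin_i_pair. Proof. by case. Qed.

HB.instance Definition _ := Choice.copy Ai (can_type adjoin_i_pairK).

Definition adjoin_i_zero : Ai := AdjoinI 0 0.
Definition adjoin_i_opp u : Ai := AdjoinI (- part1 u) (- part2 u).
Definition adjoin_i_add u v : Ai :=
  AdjoinI (part1 u + part1 v) (part2 u + part2 v).
Definition adjoin_i_one : Ai := AdjoinI 1 0.
Definition adjoin_i_mul u v : Ai :=
  AdjoinI (part1 u * part1 v - part2 u * part2 v)
          (part1 u * part2 v + part2 u * part1 v).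
Definition adjoin_i_scale k u : Ai := AdjoinI (k *: part1 u) (k *: part2 u).

Fact adjoin_i_addA : associative adjoin_i_add.
Proof. by move=> [a b] [c d] [e f]; rewrite /adjoin_i_add /= !addrA. Qed.
Fact adjoin_i_addC : commutative adjoin_i_add.
Proof. by move=> [a b] [c d]; congr AdjoinI; rewrite /= addrC. Qed.
Fact adjoin_i_add0 : left_id adjoin_i_zero adjoin_i_add.
Proof. by move=> [a b]; rewrite /adjoin_i_add /= !add0r. Qed.
Fact adjoin_i_addN : left_inverse adjoin_i_zero adjoin_i_opp adjoin_i_add.
Proof. by move=> [a b]; rewrite /adjoin_i_add /= !addNr. Qed.

HB.instance Definition _ := GRing.isZmodule.Build Ai
  adjoin_i_addA adjoin_i_addC adjoin_i_add0 adjoin_i_addN.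

Fact adjoin_i_mulA : associative adjoin_i_mul.
Proof. by move=> [a b] [c d] [e f]; congr AdjoinI => /=; ring. Qed.
Fact adjoin_i_mulC : commutative adjoin_i_mul.
Proof. by move=> [a b] [c d]; congr AdjoinI => /=; ring. Qed.
Fact adjoin_i_mul1 : left_id adjoin_i_one adjoin_i_mul.
Proof. by move=> [a b]; congr AdjoinI => /=; ring. Qed.
Fact adjoin_i_mulDl : left_distributive adjoin_i_mul +%R.
Proof. by move=> [a b] [c d] [e f]; congr AdjoinI => /=; ring. Qed.
Fact adjoin_i_one_neq0 : adjoin_i_one != 0.
Proof. by apply/eqP => -[] /eqP; rewrite oner_eq0. Qed.

HB.instance Definition _ := GRing.Zmodule_isComNzRing.Build Ai
  adjoin_i_mulA adjoin_i_mulC adjoin_i_mul1 adjoin_i_mulDl adjoin_i_one_neq0.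

Fact adjoin_i_scaleA k1 k2 u :
  adjoin_i_scale k1 (adjoin_i_scale k2 u) = adjoin_i_scale (k1 * k2) u.
Proof. by rewrite /adjoin_i_scale /= !scalerA. Qed.
Fact adjoin_i_scale1 : left_id 1 adjoin_i_scale.
Proof. by move=> [a b]; rewrite /adjoin_i_scale /= !scale1r. Qed.
Fact adjoin_i_scaleDr : right_distributive adjoin_i_scale +%R.
Proof. by move=> k [a b] [c d]; congr AdjoinI; rewrite /= scalerDr. Qed.
Fact adjoin_i_scaleDl u : {morph adjoin_i_scale^~ u : k1 k2 / k1 + k2}.
Proof. by move=> k1 k2; congr AdjoinI; rewrite /= scalerDl. Qed.

HB.instance Definition _ := GRing.Zmodule_isLmodule.Build R Ai
  adjoin_i_scaleA adjoin_i_scale1 adjoin_i_scaleDr adjoin_i_scaleDl.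

Fact adjoin_i_scaleAl k u v : k *: (u * v) = k *: u * v.
Proof.
congr AdjoinI; rewrite /= -!scalerAl; first by rewrite scalerBr.
by rewrite scalerDr.
Qed.

HB.instance Definition _ :=
  GRing.Lmodule_isLalgebra.Build R Ai adjoin_i_scaleAl.
HB.instance Definition _ := GRing.Lalgebra_isComAlgebra.Build R Ai.

Fact adjoin_i_vect_iso : Vector.axiom (dim (A * A)%type) Ai.
Proof.
exists (v2r \o adjoin_i_pair).
  by move=> k u v; exact: (linearP v2r k (adjoin_i_pair u) (adjoin_i_pair v)).
apply: bij_comp; first by exists r2v; [apply: v2rK | apply: r2vK].
by exists pair_adjoin_i; [apply: adjoin_i_pairK | apply: pair_adjoin_iK].
Qed.

HB.instance Definition _ := Lmodule_hasFinDim.Build R Ai adjoin_i_vect_iso.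

End AdjoinI.

Section Multicomplex.
Variable R : realType.

Fixpoint multicomplex (n : nat) : comAlgVectType R :=
  if n is m.+1 then adjoin_i (multicomplex m) : comAlgVectType R else R^o.

Local Notation M := multicomplex.

(* The k-th imaginary unit i_k of M(n), for 1 <= k <= n, and 0 for any other
   k; the units of M(n) are embedded in M(n+1) by x |-> AdjoinI x 0. *)
Fixpoint imag (n k : nat) : M n :=
  match n return M n with
  | 0 => 0
  | m.+1 => if k == m.+1 then AdjoinI 0 1
            else AdjoinI (imag m k) 0
  end.

(* The ordinal k : 'I_n is the index of i_(k+1). *)
Definition unit_prod (n : nat) (A : {set 'I_n}) : M n :=
  \prod_(k in A) imag n k.+1.

Definition units (n : nat) : set (M n) := range (@unit_prod n).

Definition unit_basis (n : nat) : #|{set 'I_n}|.-tuple (M n) :=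
  [tuple unit_prod (enum_val j) | j < #|{set 'I_n}|].

Definition mnorm (n : nat) (x : M n) : R :=
  Num.sqrt (\sum_j coord (unit_basis n) j x ^+ 2).

Definition Qmap (p n : nat) (c x : M n) : M n := x ^+ p + c.

Definition bounded_orbit (p n : nat) (c : M n) : Prop :=
  exists B : R, forall t : nat, (1 <= t)%N -> mnorm (iter t (Qmap p c) 0) <= B.

Definition multibrot (p n : nat) : set (M n) := [set c | bounded_orbit p c].

Definition Tspan (n : nat) (m k l : M n) : {vspace M n} := <<[:: m; k; l]>>%VS.

Definition slice (p n : nat) (m k l : M n) : set (M n) :=
  [set` Tspan m k l] `&` multibrot p (n := n).

Definition linear_hull (V : vectType R) (S : set V) : set V :=
  [set v | exists2 s : seq V, [set` s] `<=` S & v \in <<s>>%VS].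

Definition It (p n : nat) (m k l : M n) : set (M n) :=
  linear_hull [set x | exists c t,
    [/\ c \in Tspan m k l, (1 <= t)%N & x = iter t (Qmap p c) 0]].

Definition linear_on (V W : vectType R) (D : set V) (f : V -> W) : Prop :=
  forall (a : R) (x y : V), D x -> D y -> f (a *: x + y) = a *: f x + f y.

(* A map between the subspaces It is represented by the values, on the first
   one, of a map between the ambient spaces. The composite of phi, Q_c and the
   inverse of phi makes sense at x only if Q_c sends the preimage of x back
   into the domain of phi, whence the first part of the last condition. *)
Definition slice_equiv (p n : nat) (m k l : M n) (n' : nat) (r q s : M n')
    : Prop :=
  let M1 := It p m k l in
  let M2 := It p r q s in
  exists phi : M n -> M n',
    let phiV := 'pinv_(fun=> 0) M1 phi in
    [/\ linear_on M1 phi,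
        set_bij M1 M2 phi,
        phi @` [set` Tspan m k l] = [set` Tspan r q s] &
        forall c x, c \in Tspan m k l -> M2 x ->
          M1 (Qmap p c (phiV x)) /\
          (phi \o Qmap p c \o phiV) x = Qmap p (phi c) x].

Definition affine_bij (V W : vectType R) (D : {vspace V}) (E : {vspace W})
    (f : V -> W) : Prop :=
  set_bij [set` D] [set` E] f /\
  exists (g : V -> W) (b : W),
    linear_on [set` D] g /\ {in D, forall x, f x = g x + b}.

Definition unit_triple (n : nat) (m k l : M n) : Prop :=
  [/\ units m, units k, units l & uniq [:: m; k; l]].

End Multicomplex.

(* Main.v *)
Require Import Defs.
From HB Require Import structures.
From mathcomp Require Import all_boot all_order all_algebra zify ring lra.
From mathcomp Require Import all_classical all_reals all_analysis.

(* Let tau (real_part) be the coordinate at 1. For units one has tau (u v) <> 0 iff u = v,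
   so multiplicative relations between units are detected by tau. A triple of
   units therefore contains 1, or satisfies i_l = +- i_m i_k, or has all eight
   subproducts linearly independent. In the first two cases the algebra
   generated by the triple has two independent generators, in the last one
   three, and it is determined by the squares (+-1) of these generators.
   Independent units of I(3) with prescribed squares exist, except for three
   independent units of square 1, which exist in I(4). The isomorphism of
   generated algebras restricts to the phi required by the relation ~, because
   It is stable under all Q_c: polarizing c^p and c^(2p-1) shows that It is
   spanned by the monomials in the three units whose degree is odd if p is odd
   (all monomials if p is even).

   In the exceptional case all products of generators have square 1, so the
   algebra embeds by its characters in a power of the reals, and
   x i_t + y i_u + z i_v is in the slice iff all +-x +-y +-z lie in the real
   Multibrot set, an interval [-a, b]. For the tricomplex slice of 1, i1 i2,
   i1 i3 the condition is that all x +-y +-z lie in [-a, b]. Both conditions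
   define octahedra. *)

Set Implicit Arguments.
Unset Strict Implicit.
Unset Printing Implicit Defensive.

Import Order.TTheory GRing.Theory Num.Theory.

Local Open Scope classical_set_scope.
Local Open Scope ring_scope.

(** * Products of commuting generators whose squares are scalars *)

Section SignedMonomials.
Context {I : finType} {R : comNzRingType}.

Definition symdiff (S T : {set I}) : {set I} :=
  [set i | (i \in S) (+) (i \in T)]%SET.

Lemma symdiff_eq0 S T : (symdiff S T == finset.set0) = (S == T).
Proof.
apply/eqP/eqP => [/setP e | ->]; apply/setP => i; last by rewrite !inE addbb.
by have := e i; rewrite !inE; case: (i \in S); case: (i \in T).
Qed.

(** A generator common to both sets occurs squared and contributes the scalar [s i]; the others
    survive, and their indices form the symmetric difference. *)
Lemma prod_symdiff {A : comAlgType R} (s : I -> R) (g : I -> A)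
    (S T : {set I}) : (forall i, g i * g i = (s i)%:A) ->
  (\prod_(i in S) g i) * (\prod_(i in T) g i) =
  (\prod_(i in S :&: T) s i) *: \prod_(i in symdiff S T) g i.
Proof.
move=> gg; rewrite -mulr_algl -in_algE rmorph_prod.
rewrite !(big_mkcond (fun i => i \in _)) -!big_split /=; apply: eq_bigr => i _.
rewrite !inE; case: (i \in S); case: (i \in T); rewrite /= ?mul1r ?mulr1 //.
Qed.

End SignedMonomials.

(** * Frames: independent generators with prescribed squares, and the maps between the algebras they
    generate *)

Section Frame.
Context {I : finType} {R : comNzRingType} (s : I -> R) {A : comAlgType R}.
Variable tr : {scalar A}.

(** The condition on [tr] makes the products of distinct generators orthogonal for the form
    [tr (x * y)], hence linearly independent. *)
Definition frame (g : I -> A) :=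
  [/\ forall i, s i * s i = 1, forall i, g i * g i = (s i)%:A &
      forall S : {set I}, tr (\prod_(i in S) g i) = (S == finset.set0)%:R].

(** The scalar is the coefficient of [x] along the product over [S]: that product has [tr]-square
    [\prod_(i in S) s i], which is its own inverse. The formula makes sense on all of [A], so it can
    serve as the ambient map in [slice_equiv]. *)
Definition frame_map (B : comAlgType R) (g : I -> A) (h : I -> B) (x : A) : B :=
  \sum_(S : {set I})
    ((\prod_(i in S) s i) * tr (x * \prod_(i in S) g i)) *: \prod_(i in S) h i.

Fact frame_map_linear (B : comAlgType R) g (h : I -> B) :
  linear (frame_map g h).
Proof.
move=> a x y; rewrite /frame_map scaler_sumr -big_split /=.
apply: eq_bigr => S _; rewrite mulrDl -scalerAl linearP /= scalerA -scalerDl.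
by congr (_ *: _); rewrite mulrDr mulrCA.
Qed.

HB.instance Definition _ (B : comAlgType R) g (h : I -> B) :=
  GRing.isLinear.Build R A B _ (frame_map g h) (frame_map_linear g h).

(* frame_map g g is the projection onto the span of the products of the g i. *)
Definition frame_span (g : I -> A) : set A := [set x | frame_map g g x = x].

End Frame.
Arguments frame_map {I R} s {A} tr {B} g h x.
Arguments frame_span {I R} s {A} tr g.

Section FrameTheory.
Context {I : finType} {R : comNzRingType} {s : I -> R} {A : comAlgType R}.
Context {tr : {scalar A}} {g : I -> A}.
Hypothesis fg : frame s tr g.
Implicit Types S T : {set I}.

Let ss i : s i * s i = 1. Proof. by case: fg. Qed.
Let gg i : g i * g i = (s i)%:A. Proof. by case: fg. Qed.
Let trg S : tr (\prod_(i in S) g i) = (S == finset.set0)%:R. Proof. by case: fg. Qed.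

Lemma prod_frame_sqr S : (\prod_(i in S) s i) * (\prod_(i in S) s i) = 1.
Proof. by rewrite -big_split big1 // => i _; exact: ss. Qed.

Lemma tr_prodM S T :
  tr ((\prod_(i in S) g i) * (\prod_(i in T) g i)) =
  if S == T then \prod_(i in S) s i else 0.
Proof.
rewrite (prod_symdiff _ _ gg) linearZ /= trg symdiff_eq0.
by case: eqVneq => [->|_]; rewrite ?mulr0 // finset.setIid mulr1.
Qed.

Lemma frame_map_prod {B : comAlgType R} (h : I -> B) S :
  frame_map s tr g h (\prod_(i in S) g i) = \prod_(i in S) h i.
Proof.
rewrite /frame_map (bigD1 S) //= tr_prodM eqxx prod_frame_sqr scale1r.
rewrite [X in _ + X]big1 ?addr0 //.
by move=> T neTS; rewrite tr_prodM eq_sym (negbTE neTS) mulr0 scale0r.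
Qed.

Lemma frame_map1 {B : comAlgType R} (h : I -> B) : frame_map s tr g h 1 = 1.
Proof. by have := frame_map_prod h finset.set0; rewrite !big_set0. Qed.

Lemma frame_map_gen {B : comAlgType R} (h : I -> B) i :
  frame_map s tr g h (g i) = h i.
Proof. by have := frame_map_prod h [set i]%SET; rewrite !big_set1. Qed.

Lemma frame_span_linear a x y :
  frame_span s tr g x -> frame_span s tr g y -> frame_span s tr g (a *: x + y).
Proof. by move=> Dx Dy; rewrite /frame_span /= linearP /= Dx Dy. Qed.

Lemma frame_span_prod S : frame_span s tr g (\prod_(i in S) g i).
Proof. exact: frame_map_prod. Qed.

Lemma frame_span1 : frame_span s tr g 1. Proof. exact: frame_map1. Qed.

Lemma frame_span_gen i : frame_span s tr g (g i). Proof. exact: frame_map_gen. Qed.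

(** Expand [x] and [y] in products of generators: products of [g] and of [h] multiply by the same
    rule [prod_symdiff] with the same scalars. The condition on [h] concerns squares alone, so real
    signs may be taken for [h]; this gives the characters below. *)
Lemma frame_mapM {B : comAlgType R} (h : I -> B) x y :
  (forall i, h i * h i = (s i)%:A) -> frame_span s tr g x -> frame_span s tr g y ->
  frame_map s tr g h (x * y) = frame_map s tr g h x * frame_map s tr g h y.
Proof.
move=> hh Dx Dy; rewrite -{1}Dx -{1}Dy {2 3}/frame_map !mulr_suml linear_sum.
apply: eq_bigr => S _; rewrite [frame_map s tr g h y]/frame_map.
rewrite !mulr_sumr linear_sum; apply: eq_bigr => T _.
rewrite -!scalerAl -!scalerAr !linearZ /= (prod_symdiff _ _ gg) (prod_symdiff _ _ hh).
rewrite [LHS]scalerA mulrC -scalerA; congr (_ *: (_ *: _)).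
by rewrite linearZ /= frame_map_prod.
Qed.

Lemma frame_spanM x y :
  frame_span s tr g x -> frame_span s tr g y -> frame_span s tr g (x * y).
Proof.
by move=> Dx Dy; rewrite /frame_span /= frame_mapM //; congr (_ * _).
Qed.

End FrameTheory.

(** The maps sending [g] to [h] and [h] to [g] exchange the products term by term; this gives the
    injectivity of the isomorphism. *)
Lemma frame_span_map {I : finType} {R : comNzRingType} {s : I -> R}
    {A B : comAlgType R} {trA : {scalar A}} {trB : {scalar B}}
    {g : I -> A} {h : I -> B} x :
  frame s trB h -> frame_span s trA g x ->
  frame_map s trB h g (frame_map s trA g h x) = x.
Proof.
move=> fh Dx; rewrite -[RHS]Dx {2}/frame_map [in RHS]/frame_map linear_sum.
by apply: eq_bigr => S _; rewrite linearZ /= (frame_map_prod fh).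
Qed.

(** * Subspaces given as sets, and the extraction of polynomial coefficients *)

Definition subspace {R : pzRingType} {V : lmodType R} (W : set V) : Prop :=
  W 0 /\ forall a x y, W x -> W y -> W (a *: x + y).

Section Subspace.
Context {R : numFieldType} {V : lmodType R} {W : set V}.
Hypothesis subW : subspace W.

Lemma subspaceZ a x : W x -> W (a *: x).
Proof. by case: subW => W0 WD Wx; rewrite -[_ *: _]addr0; apply: WD. Qed.

Lemma subspaceD x y : W x -> W y -> W (x + y).
Proof. by case: subW => W0 WD Wx Wy; rewrite -[x]scale1r; apply: WD. Qed.

Lemma subspaceB x y : W x -> W y -> W (x - y).
Proof. by move=> Wx Wy; apply: subspaceD => //; rewrite -scaleN1r; apply: subspaceZ. Qed.

Lemma subspace_sum (J : Type) (r : seq J) (P : pred J) (F : J -> V) :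
  (forall i, P i -> W (F i)) -> W (\sum_(i <- r | P i) F i).
Proof. by move=> WF; elim/big_ind: _ => //; [case: subW | apply: subspaceD]. Qed.

Lemma subspaceZK a x : a != 0 -> W (a *: x) -> W x.
Proof.
by move=> a0 /(subspaceZ a^-1); rewrite scalerA mulVf // scale1r.
Qed.

Lemma subspaceMnK n x : (0 < n)%N -> W (x *+ n) -> W x.
Proof.
move=> n0; rewrite -scaler_nat; apply: subspaceZK.
by rewrite pnatr_eq0 -lt0n.
Qed.

(* If P(x) is the sum, then P(2x) - 2^(e N) P(x) has lost its last term. *)
Lemma subspace_coef N (e : nat -> nat) (v : nat -> V) : injective e ->
  (forall x : R, W (\sum_(j < N) x ^+ e j *: v j)) ->
  forall j, (j < N)%N -> W (v j).
Proof.
move=> inje; elim: N v => [//|N IH] v Wv.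
have Wlt j : (j < N)%N -> W (v j).
  move=> ltjN; have n0 : (2 ^+ e j - 2 ^+ e N : R) != 0.
    rewrite subr_eq0 -!natrX eqr_nat eqn_exp2l //.
    by apply/eqP => /inje ejN; rewrite ejN ltnn in ltjN.
  apply: (subspaceZK n0); move: ltjN.
  apply: (IH (fun j => (2 ^+ e j - 2 ^+ e N) *: v j)) => x.
  have := subspaceB (Wv (2 * x)) (subspaceZ (2 ^+ e N) (Wv x)).
  rewrite !big_ord_recr /= scalerDr scalerA -exprMn opprD addrACA subrr addr0.
  rewrite scaler_sumr -sumrB; congr W; apply: eq_bigr => i _.
  by rewrite !scalerA -scalerBl exprMn -mulrBl mulrC.
move=> j; rewrite ltnS leq_eqVlt => /orP[/eqP -> | /Wlt //].
have := Wv 1; rewrite big_ord_recr /= expr1n scale1r => WN.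
rewrite -[v N](addKr (\sum_(i < N) 1 ^+ e i *: v i)) addrC; apply: subspaceB => //.
by apply: subspace_sum => i _; rewrite expr1n scale1r; apply: Wlt.
Qed.

End Subspace.

(** The coefficient of x^j in the binomial expansion is the wanted element times a nonzero binomial
    coefficient. The spectator factor [z] allows polarizing twice in succession. *)
Lemma subspace_expr_coef {R : numFieldType} {A : comAlgType R} {W : set A}
    (u k z : A) d : subspace W ->
  (forall x : R, W ((u + x *: k) ^+ d * z)) ->
  forall j, (j <= d)%N -> W (u ^+ (d - j) * k ^+ j * z).
Proof.
move=> subW Wd j lejd; apply: (subspaceMnK subW (n := 'C(d, j))).
  by rewrite bin_gt0.
rewrite -ltnS in lejd; move: j lejd.
apply: (subspace_coef subW (N := d.+1) (e := id)
  (v := fun j => (u ^+ (d - j) * k ^+ j * z) *+ 'C(d, j))).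
  by [].
move=> x; have := Wd x; rewrite exprDn mulr_suml; congr W; apply: eq_bigr => i _.
by rewrite exprZn mulrnAl -scalerAr -scalerAl scalerMnr.
Qed.

Section LinearHull.
Context {R : realType} {V : vectType R}.
Implicit Types S W : set V.

Lemma linear_hull_subspace S : subspace (linear_hull S).
Proof.
split; first by exists [::] => //; rewrite mem0v.
move=> a x y [s1 s1S x1] [s2 s2S y2]; exists (s1 ++ s2).
  by move=> z /=; rewrite mem_cat => /orP[/s1S|/s2S].
by rewrite span_cat memv_add // memvZ.
Qed.

Lemma sub_linear_hull S : S `<=` linear_hull S.
Proof.
move=> x Sx; exists [:: x]; last by rewrite memv_span // mem_head.
by move=> y /=; rewrite inE => /eqP ->.
Qed.

Lemma linear_hull_min S W : subspace W -> S `<=` W -> linear_hull S `<=` W.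
Proof.
move=> subW SW x [s sS]; elim: s sS x => [|y s IH] sS x.
  by rewrite span_nil memv0 => /eqP ->; case: subW.
rewrite span_cons => /memv_addP[_ /vlineP[a ->] [z zs ->]].
case: subW => W0 WD; apply: WD; first by apply/SW/sS/mem_head.
by apply: IH zs => t ts; apply: sS; rewrite /= inE ts orbT.
Qed.

End LinearHull.

(** * The space [It] as a span of monomials, and its stability under the maps Q_c *)

Section Iterates.
Context {R : realType} {n p : nat}.
Local Notation M := (multicomplex R n).
Context {m k l : M} {sm sk sl : R}.
Hypothesis p2 : (2 <= p)%N.
Hypothesis (mm : m * m = sm%:A) (kk : k * k = sk%:A) (ll : l * l = sl%:A).
Hypothesis (sm1 : sm * sm = 1) (sk1 : sk * sk = 1) (sl1 : sl * sl = 1).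
Local Notation T := (Tspan m k l).
Local Notation V := (It p m k l).

Let subV : subspace V. Proof. exact: linear_hull_subspace. Qed.

Let It_iter c t : c \in T -> (1 <= t)%N -> V (iter t (Qmap p c) 0).
Proof. by move=> cT t1; apply: sub_linear_hull; exists c, t. Qed.

Let iter1 (c : M) : iter 1 (Qmap p c) 0 = c.
Proof. by rewrite /= /Qmap expr0n gtn_eqF ?add0r //; apply: ltnW. Qed.

Lemma Tspan_sub_It c : c \in T -> V c.
Proof. by move=> cT; have := It_iter (t := 1) cT isT; rewrite iter1. Qed.

(** The second iterate is c^p + c, and c is the first one. *)
Lemma It_expr c : c \in T -> V (c ^+ p).
Proof.
move=> cT; have := It_iter (t := 2) cT isT; rewrite iterS iter1 /Qmap.
by move/(subspaceB subV)/(_ (Tspan_sub_It cT)); rewrite addrK.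
Qed.

(** The third iterate at xc yields ((xc)^p + xc)^p for every real x; the power sought is a
    coefficient of this polynomial in x. *)
Lemma It_expr2 c : c \in T -> V (c ^+ (2 * p).-1).
Proof.
move=> cT; have Vc x : V (((x *: c) ^+ p + x *: c) ^+ p).
  have xT : x *: c \in T by rewrite memvZ.
  have := It_iter (t := 3) xT isT; rewrite 2!iterS iter1 /Qmap.
  by move/(subspaceB subV)/(_ (Tspan_sub_It xT)); rewrite addrK.
apply: (subspaceMnK subV (n := 'C(p, 1))); first by rewrite bin1 ltnW.
(* The j-th binomial term has degree p + (p - 1)j in x. These degrees are distinct because p is at
   least 2, and j = 1 gives 2p - 1. *)
have -> : ((2 * p).-1 = (p - 1) + p * 1)%N by lia.
move: (1%N) (leqW p2).
apply: (subspace_coef subV (N := p.+1) (e := fun j => (p + p.-1 * j)%N)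
  (v := fun j => c ^+ (p - j + p * j) *+ 'C(p, j))) => [i j|x]; first by nia.
have := Vc x; rewrite addrC exprDn; congr V; apply: eq_bigr => i _.
rewrite -exprM -exprD exprZn scalerMnr.
by congr (_ ^+ _ *: _); have := ltn_ord i; nia.
Qed.

Definition slice_monomials (q : nat) : set M :=
  [set x | exists a b c, x = m ^+ a * k ^+ b * l ^+ c /\
                         (odd p -> odd (a + b + c) = odd q)].

Lemma slice_monomialsM q r x y : linear_hull (slice_monomials q) x ->
  linear_hull (slice_monomials r) y -> linear_hull (slice_monomials (q + r)) (x * y).
Proof.
have subH := linear_hull_subspace (slice_monomials (q + r)).
move=> Hx Hy.
apply: (linear_hull_min (W := fun x => linear_hull (slice_monomials (q + r)) (x * y))
  _ _ Hx) => {x Hx} [|x [a [b [c [-> oddx]]]]].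
  split=> [|a x1 x2 H1 H2]; first by rewrite mul0r; case: subH.
  by rewrite mulrDl -scalerAl; case: subH => _; apply.
apply: (linear_hull_min (W := fun y => linear_hull (slice_monomials (q + r)) (_ * y))
  _ _ Hy) => {y Hy} [|y [a' [b' [c' [-> oddy]]]]].
  split=> [|e x1 x2 H1 H2]; first by rewrite mulr0; case: subH.
  by rewrite mulrDr -scalerAr; case: subH => _; apply.
apply: sub_linear_hull; exists (a + a')%N, (b + b')%N, (c + c')%N.
split; first by rewrite !exprD; ring.
move=> podd; rewrite [RHS]oddD -oddx // -oddy // -oddD; congr odd; lia.
Qed.

Lemma slice_monomialsX q x d : linear_hull (slice_monomials q) x ->
  linear_hull (slice_monomials (d * q)) (x ^+ d).
Proof.
move=> Hx; elim: d => [|d IH]; last by rewrite exprS mulSn; apply: slice_monomialsM.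
by apply: sub_linear_hull; exists 0%N, 0%N, 0%N; rewrite !expr0 !mulr1.
Qed.

Lemma Tspan_sub_monomials c : c \in T -> linear_hull (slice_monomials 1) c.
Proof.
move=> cT; exists [:: m; k; l] => // x; rewrite /= !inE => /or3P[]/eqP ->.
- by exists 1%N, 0%N, 0%N; rewrite !expr0 !mulr1.
- by exists 0%N, 1%N, 0%N; rewrite !expr0 !mulr1 mul1r.
- by exists 0%N, 0%N, 1%N; rewrite !expr0 !mul1r.
Qed.

(** If [p] is odd, a p-th power of an element of odd degree has odd degree again, like [c]. *)
Lemma Qmap_monomials c x : c \in T -> linear_hull (slice_monomials 1) x ->
  linear_hull (slice_monomials 1) (Qmap p c x).
Proof.
move=> cT Hx; apply: (subspaceD (linear_hull_subspace _)); last exact: Tspan_sub_monomials.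
have := slice_monomialsX p Hx; apply: linear_hull_min.
  exact: linear_hull_subspace.
move=> y [a [b [d [-> odde]]]]; apply: sub_linear_hull; exists a, b, d; split => //.
by move=> podd; rewrite odde // muln1 podd.
Qed.

Lemma It_sub_monomials : V `<=` linear_hull (slice_monomials 1).
Proof.
apply: linear_hull_min; first exact: linear_hull_subspace.
move=> _ [c [t [cT _ ->]]]; elim: t => [|t IH] /=; last exact: Qmap_monomials.
by case: (linear_hull_subspace (slice_monomials 1)).
Qed.

Let sqX (u : M) su i : u * u = su%:A ->
  u ^+ i = su ^+ i./2 *: u ^+ odd i.
Proof.
move=> uu; rewrite -{1}[i]odd_double_half exprD -mul2n exprM expr2 uu.
by rewrite exprZn expr1n mulrC -scalerAl mul1r.
Qed.

Let sqXn0 (s : R) i : s * s = 1 -> s ^+ i != 0.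
Proof.
move=> s1; rewrite expf_neq0 //; apply/eqP => s0.
by move: s1; rewrite s0 mul0r => /esym/eqP; rewrite oner_eq0.
Qed.

Let mT : m \in T. Proof. by rewrite memv_span // !inE eqxx. Qed.
Let kT : k \in T. Proof. by rewrite memv_span // !inE eqxx orbT. Qed.
Let lT : l \in T. Proof. by rewrite memv_span // !inE eqxx !orbT. Qed.

Let It_one : ~~ odd p -> V 1.
Proof.
move=> evp; have := It_expr mT; rewrite (sqX _ mm) // (negbTE evp) expr0.
by apply: (subspaceZK subV); apply: sqXn0.
Qed.

(** The coefficient of x in (u + xv)^p is p u^(p-1) v, and u^(p-1) is a nonzero multiple of u
    because p - 1 is odd. *)
Let It_pair (u v : M) su : ~~ odd p -> u \in T -> v \in T ->
  u * u = su%:A -> su * su = 1 -> V (u * v).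
Proof.
move=> evp uT vT uu su1.
have := subspace_expr_coef (u := u) (k := v) (z := 1) subV _ (ltnW p2).
have -> : u ^+ (p - 1) = su ^+ (p - 1)./2 *: u.
  by rewrite (sqX _ uu) (_ : odd _ = true) ?expr1 //; lia.
rewrite expr1 mulr1 -scalerAl => H.
apply: (subspaceZK subV (a := su ^+ (p - 1)./2)); first exact: sqXn0.
by apply: H => x; rewrite mulr1; apply: It_expr; rewrite rpredD // memvZ.
Qed.

(** The exponent d = 2p - 1 is odd and at least 3 for either parity of p. Polarizing c^d first along
    [k], then along [l], leaves m^(d-2) k l, and m^(d-2) is a nonzero multiple of m. *)
Let It_triple : V (m * k * l).
Proof.
have d3 : (2 < (2 * p).-1)%N by lia.
set d := (2 * p).-1 in d3 *.
have H y : V ((m + y *: l) ^+ (d - 1) * k).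
  have := subspace_expr_coef (u := m + y *: l) (k := k) (z := 1) subV _ (ltnW (ltnW d3)).
  rewrite mulr1; apply => x; rewrite mulr1; apply: It_expr2.
  by rewrite !rpredD // memvZ.
have d1 : (1 <= d - 1)%N by lia.
have := subspace_expr_coef subV H d1.
rewrite (sqX _ mm) // (_ : odd _ = true); last by rewrite /d; lia.
rewrite !expr1 -!scalerAl mulrAC; apply: (subspaceZK subV); exact: sqXn0.
Qed.

(** Squares are nonzero scalars, so exponents matter modulo 2 only and eight products remain. *)
Lemma monomials_sub_It : linear_hull (slice_monomials 1) `<=` V.
Proof.
apply: linear_hull_min => // _ [a [b [c [-> odde]]]].
rewrite (sqX _ mm) // (sqX _ kk) // (sqX _ ll) // -!scalerAl -!scalerAr -!scalerAl.
do 3! apply: (subspaceZ subV).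
move: odde; rewrite !oddD.
case: (odd a); case: (odd b); case: (odd c) => /= odde;
  rewrite ?expr0 ?expr1 ?mulr1 ?mul1r;
  try (exact: Tspan_sub_It); try exact: It_triple.
(* The four remaining products have even degree, which the parity condition allows for even [p]
   only. *)
all: have evp : ~~ odd p by apply/negP => /odde.
- exact: It_pair mm sm1.
- exact: It_pair mm sm1.
- exact: It_pair kk sk1.
- exact: It_one.
Qed.

Lemma Qmap_It c x : c \in T -> V x -> V (Qmap p c x).
Proof.
by move=> cT /It_sub_monomials Hx; apply/monomials_sub_It/Qmap_monomials.
Qed.

End Iterates.

(** * The coordinate at 1 of a multicomplex number *)

Section RealPart.
Context {R : realType}.
Local Notation M := (multicomplex R).

Fixpoint real_part (n : nat) : M n -> R :=
  match n return M n -> R with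
  | 0 => id
  | m.+1 => fun x => real_part (part1 x)
  end.

Fact real_part_scalar n : scalar (@real_part n).
Proof. by elim: n => [|n IH] a x y //=; rewrite -IH. Qed.

HB.instance Definition _ n :=
  GRing.isLinear.Build R (M n) R _ (@real_part n) (@real_part_scalar n).

Lemma adjoin_i_mulE (A : comAlgVectType R) (x y : adjoin_i A) :
  x * y = AdjoinI (part1 x * part1 y - part2 x * part2 y)
                  (part1 x * part2 y + part2 x * part1 y).
Proof. by []. Qed.

Definition extend n (x : M n) : M n.+1 := AdjoinI x 0.

Lemma extendM n : {morph @extend n : x y / x * y}.
Proof.
by move=> x y; rewrite [RHS]adjoin_i_mulE /= mulr0 mul0r addr0 mulr0 subr0.
Qed.

Lemma extend1 n : @extend n 1 = 1. Proof. by []. Qed.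

Lemma imag_sqr n k : (k < n)%N -> imag R n k.+1 * imag R n k.+1 = (-1)%:A.
Proof.
elim: n => [//|n IH]; rewrite ltnS leq_eqVlt /= eqSS.
case: eqVneq => [_ _|_ /= ltkn].
  rewrite [LHS]adjoin_i_mulE /= !(mulr0, mul0r) addr0 sub0r mulr1 scaleN1r.
  by congr AdjoinI; rewrite oppr0.
rewrite -/(extend _) -extendM IH // !scaleN1r.
by congr AdjoinI; rewrite oppr0.
Qed.

(** A factor i_n moves an element of M(n-1) entirely into the second component. The predicate [e]
    lives on [nat] so that the same one serves throughout the induction on [n]. *)
Lemma real_part_prod n (e : nat -> bool) :
  real_part (\prod_(k < n) (if e k then imag R n k.+1 else 1)) =
  [forall k : 'I_n, ~~ e k]%:R.
Proof.
elim: n => [|n IH].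
  by rewrite big_ord0 /=; case: forallP => // -[] [].
rewrite big_ord_recr /= eqxx.
have -> : \prod_(i < n) (if e i then (if i.+1 == n.+1 then AdjoinI 0 1
    else AdjoinI (imag R n i.+1) 0) else 1 : M n.+1) =
    extend (\prod_(k < n) (if e k then imag R n k.+1 else 1)).
  rewrite (big_morph _ (@extendM n) (@extend1 n)); apply: eq_bigr => i _.
  by rewrite eqSS ltn_eqF //; case: (e i).
case en: (e n).
  rewrite /= mulr0 mul0r subr0 raddf0.
  by case: forallP => // /(_ ord_max); rewrite en.
rewrite mulr1 mul0r subr0 IH; congr ((nat_of_bool _)%:R); apply/forallP/forallP => H i.
  by case: (unliftP ord_max i) => [j ->|->]; rewrite ?en // lift_max.
by have := H (widen_ord (leqnSn n) i).
Qed.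

End RealPart.

(** * Units: orthogonality, basis property and independent families *)

Section Units.
Context {R : realType}.
Local Notation M := (multicomplex R).
Local Notation tau := (@real_part R _).

Lemma real_part_unit_prod n (S : {set 'I_n}) :
  real_part (unit_prod R S) = (S == finset.set0)%:R.
Proof.
have ordK (i : 'I_n) : insub (i : nat) = Some i := valK i.
rewrite /unit_prod big_mkcond /=.
(* [insub] extends membership in [S] to all natural numbers, with value [false] outside the
   range. *)
have := real_part_prod (R := R) n (fun k => if insub k is Some i then i \in S else false).
move=> /=; under eq_bigr => i _ do rewrite ordK; move=> ->; congr ((nat_of_bool _)%:R).
apply/forallP/eqP => [H|-> i]; last by rewrite ordK inE.
by apply/setP => i; have := H i; rewrite ordK inE => /negbTE.
Qed.

Lemma unit_prod0 n : unit_prod R (finset.set0 : {set 'I_n}) = 1.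
Proof. by rewrite /unit_prod big_set0. Qed.

Lemma imag_frame n :
  frame (fun=> -1) (@real_part R n) (fun k : 'I_n => imag R n k.+1).
Proof.
split=> [_|k|S]; first by rewrite mulrNN mulr1.
  exact: imag_sqr.
exact: real_part_unit_prod.
Qed.

Lemma unit_prod_sqr n (S : {set 'I_n}) :
  unit_prod R S * unit_prod R S = ((-1) ^+ odd #|S|)%:A.
Proof.
have [_ sq _] := imag_frame n.
rewrite (prod_symdiff _ _ sq) finset.setIid prodr_const signr_odd.
have /eqP -> : symdiff S S == finset.set0 by rewrite symdiff_eq0.
by rewrite big_set0.
Qed.

Lemma unit_prodM n (S T : {set 'I_n}) : exists e : bool,
  unit_prod R S * unit_prod R T = (-1) ^+ e *: unit_prod R (symdiff S T).
Proof.
have [_ sq _] := imag_frame n.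
exists (odd #|S :&: T|)%SET.
by rewrite [LHS](prod_symdiff _ _ sq) prodr_const signr_odd.
Qed.

Lemma real_part_unit2 n (S T : {set 'I_n}) :
  real_part (unit_prod R S * unit_prod R T) =
  if S == T then (-1) ^+ #|S| else 0.
Proof. by rewrite (tr_prodM (imag_frame n)) prodr_const. Qed.

Lemma unit_prod_inj n : injective (@unit_prod R n).
Proof.
move=> S T ST; apply/eqP; have := real_part_unit2 S T.
rewrite ST real_part_unit2 eqxx; case: eqP => // _ /eqP.
by rewrite signr_eq0.
Qed.

Lemma dim_multicomplex n : dim (M n) = (2 ^ n)%N.
Proof. by elim: n => [//|n IH]; rewrite expnS mul2n -addnn -IH. Qed.

(** Multiplying a linear relation by one of the units and taking real parts isolates the coefficient
    of that unit. *)
Lemma unit_basis_free n : free (unit_basis R n).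
Proof.
apply/freeP => k k0 i.
have := congr1 (fun x => real_part (x * unit_prod R (enum_val i))) k0.
rewrite mul0r raddf0 mulr_suml raddf_sum /= (bigD1 i) //= big1 ?addr0.
  rewrite (nth_map i) ?size_enum_ord // nth_ord_enum.
  rewrite -scalerAl linearZ /= real_part_unit2 eqxx => /eqP.
  by rewrite mulf_eq0 signr_eq0 orbF => /eqP.
move=> j neji; rewrite (nth_map i) ?size_enum_ord // nth_ord_enum.
rewrite -scalerAl linearZ /= real_part_unit2 (inj_eq enum_val_inj).
by rewrite (negbTE neji) mulr0.
Qed.

Lemma unit_basis_full n : basis_of {:M n} (unit_basis R n).
Proof.
rewrite basisEfree unit_basis_free subvf dimvf dim_multicomplex size_tuple.
by rewrite -cardsT -powersetT card_powerset cardsT card_ord leqnn.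
Qed.

Lemma coord_unit_basis n (x : M n) j :
  coord (unit_basis R n) j x =
  (-1) ^+ #|enum_val j| * real_part (x * unit_prod R (enum_val j)).
Proof.
rewrite {2}(coord_basis (unit_basis_full n) (memvf x)).
rewrite mulr_suml raddf_sum (bigD1 j) //= big1 ?addr0.
  rewrite (nth_map j) ?size_enum_ord // nth_ord_enum.
  rewrite -scalerAl linearZ /= real_part_unit2 eqxx.
  by rewrite mulrCA -expr2 sqrr_sign mulr1.
move=> i neij; rewrite (nth_map i) ?size_enum_ord // nth_ord_enum.
rewrite -scalerAl linearZ /= real_part_unit2 (inj_eq enum_val_inj).
by rewrite (negbTE neij) mulr0.
Qed.

Lemma unit_prod_frame n (I : finType) (F : I -> {set 'I_n}) (e : I -> bool) :
  (forall i, odd #|F i| = e i) ->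
  (forall S : {set I}, S != finset.set0 ->
     real_part (\prod_(i in S) unit_prod R (F i)) = 0) ->
  frame (fun i => (-1) ^+ e i) (@real_part R n) (fun i => unit_prod R (F i)).
Proof.
move=> Fe F0; split=> [i|i|S]; first by rewrite -expr2 sqrr_sign.
  by rewrite unit_prod_sqr Fe.
case: eqVneq => [->|/F0 //]; rewrite big_set0.
have := real_part_unit_prod (finset.set0 : {set 'I_n}).
by rewrite unit_prod0 eqxx.
Qed.

Lemma unit_frame2 n (A B : {set 'I_n}) :
  A != finset.set0 -> B != finset.set0 -> A != B ->
  frame (fun i : 'I_2 => (-1) ^+ nth false [:: odd #|A|; odd #|B|] i)
    (@real_part R n)
    (fun i : 'I_2 => unit_prod R (nth finset.set0 [:: A; B] i)).
Proof.
move=> A0 B0 AB; apply: unit_prod_frame => [[[|[|i]] lti]//|S S0].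
rewrite big_mkcond /= !big_ord_recl big_ord0 /= mulr1.
case: ifP => H0; case: ifP => H1; rewrite ?mulr1 ?mul1r.
- by rewrite real_part_unit2 (negbTE AB).
- by rewrite real_part_unit_prod (negbTE A0).
- by rewrite real_part_unit_prod (negbTE B0).
case/set0Pn: S0 => -[[|[|i]] lti] //.
  by rewrite (_ : Ordinal _ = ord0) ?H0 //; apply: val_inj.
by rewrite (_ : Ordinal _ = lift ord0 ord0) ?H1 //; apply: val_inj.
Qed.

(** None of the seven nonempty subproducts is a scalar; equivalently, the three sets are linearly
    independent over the field with two elements, with [symdiff] as addition. *)
Definition independent3 n (A B C : {set 'I_n}) : bool :=
  [&& A != finset.set0, B != finset.set0, C != finset.set0,
      A != B, A != C, B != C & symdiff A B != C].

Lemma unit_frame3 n (A B C : {set 'I_n}) :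
  independent3 A B C ->
  frame (fun i : 'I_3 => (-1) ^+ nth false [:: odd #|A|; odd #|B|; odd #|C|] i)
    (@real_part R n)
    (fun i : 'I_3 => unit_prod R (nth finset.set0 [:: A; B; C] i)).
Proof.
move=> /and5P[A0 B0 C0 AB /and3P[AC BC ABC]].
apply: unit_prod_frame => [[[|[|[|i]]] lti]//|S S0].
rewrite big_mkcond /= !big_ord_recl big_ord0 /= mulr1.
case: ifP => H0; case: ifP => H1; case: ifP => H2; rewrite ?mulr1 ?mul1r;
  rewrite ?real_part_unit2 ?real_part_unit_prod ?(negbTE A0) ?(negbTE B0)
    ?(negbTE C0) ?(negbTE AB) ?(negbTE AC) ?(negbTE BC) //.
  have [e abE] := unit_prodM A B.
  by rewrite mulrA abE -scalerAl linearZ /= real_part_unit2 (negbTE ABC) mulr0.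
case/set0Pn: S0 => -[[|[|[|i]]] lti] //.
- by rewrite (_ : Ordinal _ = ord0) ?H0 //; apply: val_inj.
- by rewrite (_ : Ordinal _ = lift ord0 ord0) ?H1 //; apply: val_inj.
by rewrite (_ : Ordinal _ = lift ord0 (lift ord0 ord0)) ?H2 //; apply: val_inj.
Qed.

End Units.

(** * Frame maps carry orbits to orbits and induce the relation ~ *)

Section FrameOrbits.
Context {R : numFieldType} {I : finType} {s : I -> R} {A : comAlgType R}.
Context {tr : {scalar A}} {g : I -> A}.
Hypothesis fg : frame s tr g.
Local Notation D := (frame_span s tr g).

Lemma frame_span_subspace : subspace D.
Proof.
split; first by rewrite /frame_span /= raddf0.
exact: frame_span_linear.
Qed.

Lemma frame_spanX x d : D x -> D (x ^+ d).
Proof.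
move=> Dx; elim: d => [|d IH]; first exact: frame_span1.
by rewrite exprS; apply: frame_spanM.
Qed.

Lemma frame_span_orbit p c t : D c -> D (iter t (fun x => x ^+ p + c) 0).
Proof.
move=> Dc; elim: t => [|t IH]; first by case: frame_span_subspace.
by apply: (subspaceD frame_span_subspace) => //; apply: frame_spanX.
Qed.

Context {B : comAlgType R} {h : I -> B}.
Hypothesis hh : forall i, h i * h i = (s i)%:A.
Local Notation phi := (frame_map s tr g h).

Lemma frame_mapX x d : D x -> phi (x ^+ d) = phi x ^+ d.
Proof.
move=> Dx; elim: d => [|d IH]; first exact: frame_map1.
by rewrite !exprS (frame_mapM fg) // ?IH //; apply: frame_spanX.
Qed.

Lemma frame_map_orbit p c t : D c ->
  phi (iter t (fun x => x ^+ p + c) 0) = iter t (fun x => x ^+ p + phi c) 0.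
Proof.
move=> Dc; elim: t => [|t IH] /=; first by rewrite raddf0.
by rewrite raddfD /= frame_mapX ?IH //; apply: frame_span_orbit.
Qed.

End FrameOrbits.

Section FrameEquivalence.
Context {R : realType} {p n n' : nat} {I : finType} {s : I -> R}.
Local Notation M := (multicomplex R n).
Local Notation M' := (multicomplex R n').
Context {g : I -> M} {h : I -> M'} {A B C : {set 'I_n}} {r q u : M'}.
Hypothesis p2 : (2 <= p)%N.
Hypothesis fg : frame s (@real_part R n) g.
Hypothesis fh : frame s (@real_part R n') h.
Local Notation m := (unit_prod R A).
Local Notation k := (unit_prod R B).
Local Notation l := (unit_prod R C).
Local Notation D := (frame_span s (@real_part R n) g).
Local Notation phi := (frame_map s (@real_part R n) g h).
Hypothesis (Dm : D m) (Dk : D k) (Dl : D l).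
Hypothesis phiT : phi @` [set` Tspan m k l] = [set` Tspan r q u].

Let subD : subspace D := frame_span_subspace.

Let hh i : h i * h i = (s i)%:A. Proof. by case: fh. Qed.

Let DT c : c \in Tspan m k l -> D c.
Proof.
move=> cT; apply: (linear_hull_min subD (S := [set` [:: m; k; l]])); last first.
  by exists [:: m; k; l].
by move=> y /=; rewrite !inE => /or3P[]/eqP ->.
Qed.

Let It_D : It p m k l `<=` D.
Proof.
by apply: linear_hull_min => // _ [c [t [/DT Dc _ ->]]]; apply: frame_span_orbit.
Qed.

Let phi_mem c : c \in Tspan m k l -> phi c \in Tspan r q u.
Proof. by move=> cT; have /seteqP[+ _] := phiT; apply; exists c. Qed.

(** The span [D] is a subalgebra containing the triple, so it contains [It]. On [D] the map [phi] is
    an injective homomorphism, hence it commutes with the iteration. *)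
Lemma slice_equiv_frame : slice_equiv p m k l r q u.
Proof.
have subV : subspace (It p m k l) by exact: linear_hull_subspace.
have subV' : subspace (It p r q u) by exact: linear_hull_subspace.
have bij_phi : set_bij (It p m k l) (It p r q u) phi.
  split.
  - move=> x; apply: (linear_hull_min (W := fun x => It p r q u (phi x))).
      split=> [|a y z Hy Hz]; first by rewrite raddf0; case: subV'.
      by rewrite linearP; case: subV' => _; apply.
    move=> _ [c [t [cT t1 ->]]]; rewrite (frame_map_orbit fg hh _ _ (DT cT)).
    apply: sub_linear_hull.
    by exists (phi c), t; split => //; apply: phi_mem.
  - move=> x y; rewrite !inE => /It_D Dx /It_D Dy xy.
    by rewrite -(frame_span_map fh Dx) xy (frame_span_map fh Dy).
  (* Surjectivity: the image of the first [It] is a subspace, so it suffices to reach every iterate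
     of the second slice. *)
  apply: linear_hull_min.
    split=> [|a _ _ [x Vx <-] [y Vy <-]].
      by exists 0; rewrite ?raddf0 //; case: subV.
    by exists (a *: x + y); rewrite ?linearP //; case: subV => _; apply.
  move=> _ [c [t [cT t1 ->]]]; have /seteqP[_ /(_ c cT)[d dT <-]] := phiT.
  exists (iter t (Qmap p d) 0); last by apply: (frame_map_orbit fg hh); apply: DT.
  by apply: sub_linear_hull; exists d, t.
exists phi; split => //.
  by move=> a x y _ _; rewrite linearP.
move=> c x cT M2x; have [_ _ surj] := bij_phi.
have V1 : It p m k l ('pinv_(fun=> 0) (It p m k l) phi x).
  by apply: (surjpinv_image_sub surj); exists x.
split; first by apply: (Qmap_It p2 (unit_prod_sqr A) (unit_prod_sqr B)
  (unit_prod_sqr C)) V1 => //; rewrite -expr2 sqrr_sign.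
rewrite /comp /Qmap raddfD /= (frame_mapX fg hh); last exact: It_D.
by congr (_ ^+ _ + _); apply: (surjpK _ surj); rewrite inE.
Qed.

End FrameEquivalence.

(** * Characters: boundedness of orbits reduced to the real line *)

Definition real_bounded {R : numDomainType} (p : nat) (y : R) : Prop :=
  exists b, forall t, `|iter t (fun x => x ^+ p + y) 0| <= b.

Section Characters.
Context {R : realType} {n p : nat} {I : finType} {g : I -> multicomplex R n}.
Local Notation M := (multicomplex R n).
Local Notation tau := (@real_part R n).
Hypothesis fg : frame (fun=> 1) tau g.
Local Notation D := (frame_span (fun=> 1) tau g).

(** On the algebra spanned by the frame this is the homomorphism to the reals that sends the
    generators in [E] to -1 and the others to 1. *)
Definition character (E : {set I}) (x : M) : R :=
  frame_map (B := R^o) (fun=> 1) tau g (fun i => (-1) ^+ (i \in E)) x.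

Lemma characterE E x : character E x =
  \sum_(S : {set I}) tau (x * \prod_(i in S) g i) *
                     \prod_(i in S) (-1) ^+ (i \in E).
Proof. by apply: eq_bigr => S _; rewrite big1_eq mul1r. Qed.

Let sign_sqr (E : {set I}) i :
  ((-1) ^+ (i \in E) : R^o) * (-1) ^+ (i \in E) = 1%:A.
Proof. by rewrite -expr2 sqrr_sign scale1r. Qed.

(** Fourier inversion on the group of sign patterns: for fixed [S] the sum over [E] factors over the
    generators, and each generator in [S] contributes -1 + 1 = 0. *)
Lemma sum_characters x : \sum_E character E x = 2 ^+ #|I| * tau x.
Proof.
under eq_bigr do rewrite characterE; rewrite exchange_big /=.
under eq_bigr do rewrite -mulr_sumr.
have sumE (S : {set I}) : \sum_(E : {set I}) \prod_(i in S) (-1) ^+ (i \in E) =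
    \prod_i ((-1) ^+ (i \in S) + 1) :> R.
  rewrite bigA_distr; apply: eq_bigr => E _; rewrite big_mkcond; apply: eq_bigr.
  by move=> i _; case: (i \in S); case: (i \in E).
rewrite (bigD1 finset.set0) //= [X in _ + X]big1 ?addr0.
  rewrite big_set0 mulr1 mulrC sumE; congr (_ * _).
  by under eq_bigr do rewrite inE; rewrite prodr_const.
move=> S S0; have [i iS] : exists i, i \in S by apply/finset.set0Pn.
by rewrite sumE [X in _ * X](bigD1 i) //= iS addNr mul0r mulr0.
Qed.

Lemma real_part_bound (y : M) : exists2 C, 0 <= C &
  forall x, `|tau (x * y)| <= C * mnorm x.
Proof.
have coord_le x j : `|coord (unit_basis R n) j x| <= mnorm x.
  rewrite -sqrtr_sqr ler_wsqrtr // (bigD1 j) //= lerDl.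
  by apply: sumr_ge0 => i _; apply: sqr_ge0.
exists (\sum_(j < #|{set 'I_n}|) `|tau ((unit_basis R n)`_j * y)|) => [|x].
  by apply: sumr_ge0.
rewrite {1}(coord_basis (unit_basis_full n) (memvf x)).
rewrite mulr_suml raddf_sum mulr_suml.
apply: le_trans (ler_norm_sum _ _ _) _; apply: ler_sum => j _.
by rewrite /= -scalerAl linearZ /= normrM mulrC ler_wpM2l.
Qed.

Lemma mnorm_bound (b : R) : exists B, forall x : M,
  (forall S, `|tau (x * unit_prod R S)| <= b) -> mnorm x <= B.
Proof.
exists (Num.sqrt (\sum_(j < #|{set 'I_n}|) b ^+ 2)) => x xb.
apply: ler_wsqrtr; apply: ler_sum => j _.
rewrite coord_unit_basis exprMn sqrr_sign mul1r -real_normK ?num_real //.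
by rewrite lerXn2r ?nnegrE // ?xb // (le_trans _ (xb finset.set0)).
Qed.

Lemma character_bound E : exists2 C, 0 <= C &
  forall x, `|character E x| <= C * mnorm x.
Proof.
have /choice[C C0] : forall S : {set I}, exists C, 0 <= C /\
    forall x, `|tau (x * \prod_(i in S) g i)| <= C * mnorm x.
  by move=> S; have [C ? ?] := real_part_bound (\prod_(i in S) g i); exists C.
exists (\sum_S C S) => [|x]; first by apply: sumr_ge0 => S _; case: (C0 S).
rewrite characterE mulr_suml; apply: le_trans (ler_norm_sum _ _ _) _.
apply: ler_sum => S _; rewrite normrM [X in _ * X](_ : _ = 1) ?mulr1.
  by case: (C0 S).
by rewrite normr_prod big1 // => i _; rewrite normrX normrN1 expr1n.
Qed.

(** Apply [sum_characters] to [x] times a product of generators: characters are multiplicative and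
    take the values 1 and -1 on such products. *)
Lemma coef_bound (b : {set I} -> R) x : D x ->
  (forall E, `|character E x| <= b E) ->
  forall S : {set I}, `|tau (x * \prod_(i in S) g i)| <= \sum_E b E.
Proof.
move=> Dx xb S; have b0 (E : {set I}) : 0 <= b E by apply: le_trans (xb E).
have sum0 : 0 <= \sum_E b E by apply: sumr_ge0.
rewrite -(ler_pM2l (exprn_gt0 #|I| (ltr0Sn R 1))).
apply: (@le_trans _ _ (\sum_E b E)); last first.
  by rewrite ler_peMl // exprn_ege1 // ler1n.
rewrite -[X in X * _ <= _]ger0_norm ?exprn_ge0 // -normrM -sum_characters.
apply: le_trans (ler_norm_sum _ _ _) _; apply: ler_sum => E _.
rewrite /character (frame_mapM fg (sign_sqr E)) //; last exact: (frame_span_prod fg).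
rewrite (frame_map_prod fg) normrM [X in _ * X](_ : _ = 1) ?mulr1; first exact: xb.
by rewrite normr_prod big1 // => i _; rewrite normrX normrN1 expr1n.
Qed.

(** Characters commute with the iteration, and on the span of the frame the norm and the family of
    all characters bound each other. *)
Lemma bounded_orbit_characters c : D c ->
  bounded_orbit p c <-> forall E, real_bounded p (character E c).
Proof.
move=> Dc.
have orbE E t : iter t (fun x => x ^+ p + character E c) 0 =
    character E (iter t (Qmap p c) 0).
  by rewrite [RHS](frame_map_orbit fg (sign_sqr E)).
split=> [[b cb] E|cb].
  (* [real_bounded] includes t = 0, which [bounded_orbit] omits; there the orbit is 0, and the first
     iterate shows that [b] is nonnegative. *)
  have [C C0 CE] := character_bound E; exists (C * b) => -[|t].
    have mn0 : 0 <= mnorm (iter 1 (Qmap p c) 0) by apply: sqrtr_ge0.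
    by rewrite normr0 mulr_ge0 // (le_trans mn0) ?cb.
  by rewrite orbE (le_trans (CE _)) // ler_wpM2l ?cb.
have /choice[b bE] := cb.
pose a := \sum_E b E.
(* This bounds every coordinate of an iterate, expanded in products of generators; summing over [A]
   as well makes the bound uniform in the coordinate. *)
pose d := \sum_(S : {set I}) \sum_(A : {set 'I_n})
  a * `|tau ((\prod_(i in S) g i) * unit_prod R A)|.
have [B Bd] := mnorm_bound d; exists B => t _; apply: Bd => A.
have Dt : D (iter t (Qmap p c) 0) := frame_span_orbit fg p t Dc.
have xb E : `|character E (iter t (Qmap p c) 0)| <= b E by rewrite -orbE.
have coefa := coef_bound Dt xb.
have a0 : 0 <= a by apply: le_trans (coefa finset.set0).
rewrite -{1}Dt /frame_map mulr_suml raddf_sum.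
apply: le_trans (ler_norm_sum _ _ _) _; apply: ler_sum => S _.
rewrite big1_eq mul1r /= -scalerAl linearZ /= normrM.
rewrite (bigD1 A) //= -[leLHS]addr0 lerD ?ler_wpM2r ?coefa //.
by apply: sumr_ge0 => T _; apply: mulr_ge0.
Qed.

End Characters.

(** * The real Multibrot set is an interval *)

Section RealMultibrot.
Import numFieldNormedType.Exports.
Context {R : realType} {p : nat}.
Hypothesis p2 : (2 <= p)%N.
Local Notation orbit c t := (iter t (fun x : R => x ^+ p + c) 0).

Lemma not_real_bounded (c d : R) t0 : 0 < d ->
  (forall t, (t0 <= t)%N -> `|orbit c t| + d <= `|orbit c t.+1|) ->
  ~ real_bounded p c.
Proof.
move=> d0 grow [b cb].
have lin k : k%:R * d <= `|orbit c (t0 + k)|.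
  elim: k => [|k IH]; first by rewrite mul0r.
  rewrite addnS (le_trans _ (grow _ (leq_addr _ _))) //.
  by rewrite -natr1 mulrDl mul1r lerD2r.
have b0 : 0 <= b / d by rewrite divr_ge0 ?(le_trans _ (cb 0%N)) // ltW.
have := archi_boundP b0; rewrite ltNge => /negP; apply.
by rewrite ler_pdivlMr // (le_trans (lin _)).
Qed.

Lemma orbit_ge0 (c : R) t : 0 <= c -> 0 <= orbit c t.
Proof. by move=> c0; elim: t => [|t IH] //=; rewrite addr_ge0 ?exprn_ge0. Qed.

Lemma orbit_le (c c' : R) t : 0 <= c -> c <= c' -> orbit c t <= orbit c' t.
Proof.
move=> c0 cc'; elim: t => [|t IH] //=; apply: lerD => //.
by rewrite lerXn2r ?nnegrE ?orbit_ge0 // (le_trans c0).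
Qed.

(** Once z is at least 2, z^p + c is at least z^2, hence exceeds z by at least 1, and the orbit
    escapes. *)
Lemma real_bounded_ge0 (c : R) : 0 <= c ->
  real_bounded p c <-> forall t, orbit c t <= 2.
Proof.
move=> c0; split=> [cb t|c2]; last first.
  by exists 2 => t; rewrite ger0_norm ?orbit_ge0.
rewrite leNgt; apply/negP => t2.
apply: (@not_real_bounded c 1 t) cb => // k tk.
have : 2 <= orbit c k.
  elim: k tk => [|k IH]; first by rewrite leqn0 => /eqP t0; move: t2; rewrite t0 => /ltW.
  rewrite leq_eqVlt => /orP[/eqP <-|]; first exact: ltW.
  rewrite ltnS => /IH z2 /=; apply: ler_wpDr => //.
  have z1 : 1 <= orbit c k by lra.
  by apply: le_trans z2 _; rewrite -{1}[orbit c k]expr1 ler_weXn2l // ltnW.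
move=> z2; rewrite !ger0_norm ?orbit_ge0 //=.
have z1 : 1 <= orbit c k by lra.
have := ler_weXn2l z1 p2; rewrite expr2; nra.
Qed.

Lemma orbit_continuous t : continuous (fun c : R => orbit c t).
Proof.
elim: t => [|t IH] c; first exact: cvg_cst.
apply: cvgD; last exact: cvg_id.
apply: (@continuous_comp R R R (fun c => orbit c t) (fun x => x ^+ p)).
  exact: IH.
exact: exprn_continuous.
Qed.

(** The nonnegative parameters form a closed set by continuity of the iterates, so it contains its
    supremum; monotonicity of the orbit in [c] fills the interval below. *)
Lemma real_bounded_nonneg_interval : exists2 b : R, 0 < b &
  forall c, 0 <= c -> real_bounded p c <-> c <= b.
Proof.
pose A := [set c : R | 0 <= c /\ forall t, orbit c t <= 2].
(* This makes the supremum positive: for c = 1/4 the interval [0, 1/2] is invariant, since z^p is at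
   most z^2 there. *)
have A4 : A (1 / 4).
  split=> [|t]; first by lra.
  have : 0 <= orbit (1 / 4) t <= 1 / 2; last by lra.
  elim: t => [|t /andP[z0 z2]]; first by rewrite /= lexx; lra.
  rewrite orbit_ge0 /=; last by lra.
  have z1 : orbit (1 / 4) t <= 1 by lra.
  have := ler_wiXn2l z0 z1 p2; rewrite expr2; nra.
have A2 : ubound A 2.
  move=> c [c0 /(_ 1%N)] /=; rewrite expr0n gtn_eqF ?add0r //; exact: ltnW.
have clA : closed A.
  rewrite (_ : A = [set c | 0 <= c] `&` \bigcap_t [set c | orbit c t <= 2]).
    apply: closedI; first exact: closed_ge.
    apply: closed_bigI => t _.
    apply: (@preimage_closed _ _ (fun c => orbit c t) [set x | x <= 2]).
      by move=> c _; apply: orbit_continuous.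
    exact: closed_le.
  by apply/seteqP; split=> c [c0 ct]; split=> // t; [move=> _|]; apply: ct.
have [supA0 supA] : A (sup A).
  by apply: clA; apply: closure_sup; [exists (1 / 4) | exists 2].
have subA c : A c -> c <= sup A by move=> Ac; apply: ub_le_sup => //; exists 2.
exists (sup A) => [|c c0].
  by apply: lt_le_trans (subA _ A4); lra.
split=> [/(real_bounded_ge0 c0) ct|csup]; first exact: subA.
by apply/(real_bounded_ge0 c0) => t; apply: le_trans (supA t); apply: orbit_le.
Qed.

Lemma real_bounded_odd (c : R) : odd p -> real_bounded p c -> real_bounded p (- c).
Proof.
move=> podd [b cb]; exists b => t.
suff -> : orbit (- c) t = - orbit c t by rewrite normrN.
elim: t => [|t IH]; first by rewrite oppr0.
by rewrite !iterS IH exprNn -signr_odd podd expr1 mulN1r opprD.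
Qed.

(** The condition says c^p - c is at most c, which makes [-c, c] invariant. Otherwise the modulus
    grows from t = 1 on by at least (c^(p-1) - 2)c at each step. *)
Lemma real_bounded_even (c : R) : ~~ odd p -> 0 <= c ->
  real_bounded p (- c) <-> c ^+ p.-1 <= 2.
Proof.
move=> peven c0.
have pS : p = p.-1.+1 by rewrite prednK // ltnW.
have absX (x : R) : `|x ^+ p| = x ^+ p.
  by rewrite ger0_norm // exprn_even_ge0.
split=> [cb|c2]; last first.
  exists c => t; elim: t => [|t IH]; first by rewrite normr0.
  rewrite iterS; set z := orbit _ _ in IH *.
  have zp0 : 0 <= z ^+ p by rewrite exprn_even_ge0.
  have : z ^+ p <= c * 2.
    rewrite -absX normrX (le_trans (y := c ^+ p)) ?lerXn2r ?nnegrE //.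
    by rewrite {1}pS exprS ler_wpM2l.
  by rewrite ler_norml => ?; apply/andP; split; lra.
rewrite leNgt; apply/negP => c2.
have cpos : 0 < c.
  rewrite lt_neqAle c0 andbT; apply/eqP => c00; move: c2.
  by rewrite -c00 expr0n; case: (p.-1 == 0%N) => /=; lra.
pose d := c ^+ p.-1 - 2; have d0 : 0 < d by rewrite subr_gt0.
have grow (z : R) : c <= `|z| -> `|z| + d * c <= `|z ^+ p - c|.
  move=> cz; apply: le_trans (ler_norm _); rewrite -absX normrX {1}pS exprS.
  have : c ^+ p.-1 <= `|z| ^+ p.-1 by rewrite lerXn2r ?nnegrE.
  by rewrite /d in d0 *; nra.
have large t : (1 <= t)%N -> c <= `|orbit (- c) t|.
  elim: t => [//|[|t] IH] _.
    by rewrite /= expr0n gtn_eqF ?add0r ?normrN ?ler_norm // ltnW.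
  rewrite iterS; apply: le_trans (grow _ (IH isT)); apply: le_trans (IH isT) _.
  by rewrite lerDl mulr_ge0 // ltW.
apply: (@not_real_bounded (- c) (d * c) 1) cb => [|t t1]; first exact: mulr_gt0.
by rewrite iterS; apply: grow; apply: large.
Qed.

Lemma real_bounded_interval : exists a b : R,
  [/\ 0 < a, 0 < b & forall c, real_bounded p c <-> - a <= c <= b].
Proof.
have [b b0 cb] := real_bounded_nonneg_interval.
suff [a a0 ca] : exists2 a : R, 0 < a &
    forall c, 0 <= c -> real_bounded p (- c) <-> c <= a.
  exists a, b; split => // c; have [c0|c0] := leP 0 c.
    split=> [/(cb _ c0) ->|/andP[_]]; last exact: (cb _ c0).2.
    by rewrite andbT; lra.
  have nc : 0 <= - c by lra.
  rewrite -[c in real_bounded _ c]opprK.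
  split=> [/(ca _ nc) ?|/andP[? _]]; first by apply/andP; split; lra.
  by apply/(ca _ nc); lra.
case podd: (odd p).
  exists b => // c c0; split=> [/(real_bounded_odd podd)|/(cb _ c0) H].
    by rewrite opprK => /(cb _ c0).
  exact: real_bounded_odd.
have q0 : (0 < p.-1)%N by lia.
(* For even [p] the left endpoint is minus the (p - 1)-st root of 2. *)
exists (2 `^ p.-1%:R^-1) => [|c c0]; first exact: powR_gt0.
apply: iff_trans (real_bounded_even (negbT podd) c0) _.
have root2 : (2 `^ p.-1%:R^-1) ^+ p.-1 = 2 :> R.
  by rewrite -powR_mulrn ?powR_ge0 // -powRrM mulVf ?powRr1 // pnatr_eq0 -lt0n.
by rewrite -{1}root2 ler_pXn2r ?nnegrE ?powR_ge0.
Qed.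

End RealMultibrot.

(** * Equivalences between slices whose units have matching squares *)

Section Slices.
Context {R : realType} {p : nat}.
Hypothesis p2 : (2 <= p)%N.
Local Notation M := (multicomplex R).
Local Notation u S := (unit_prod R S).

Lemma TspanP n (m k l v : M n) :
  reflect (exists x y z, v = x *: m + y *: k + z *: l) (v \in Tspan m k l).
Proof.
rewrite /Tspan !span_cons span_nil addv0.
apply: (iffP idP) => [|[x [y [z ->]]]]; last first.
  by rewrite -addrA !memv_add // memvZ ?memv_line.
case/memv_addP=> _ /vlineP[x ->] [_ /memv_addP[_ /vlineP[y ->] [_ /vlineP[z ->] ->]] ->].
by exists x, y, z; rewrite addrA.
Qed.

Lemma image_Tspan n n' (f : {linear M n -> M n'}) (m k l : M n) :
  f @` [set` Tspan m k l] = [set` Tspan (f m) (f k) (f l)].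
Proof.
apply/seteqP; split=> [_ [v /TspanP[x [y [z ->]]] <-]|v /TspanP[x [y [z ->]]]].
  by apply/TspanP; exists x, y, z; rewrite !linearD !linearZ.
exists (x *: m + y *: k + z *: l); first by apply/TspanP; exists x, y, z.
by rewrite !linearD !linearZ.
Qed.

Lemma Tspan_sign n (m k l : M n) (e : bool) :
  Tspan m k ((-1) ^+ e *: l) = Tspan m k l.
Proof.
apply/vspaceP => v; apply/TspanP/TspanP => -[x [y [z ->]]]; exists x, y.
  by exists (z * (-1) ^+ e); rewrite scalerA.
by exists (z * (-1) ^+ e); rewrite scalerA -mulrA -expr2 sqrr_sign mulr1.
Qed.

Lemma slice_equiv_Tspan n n' (m k l m' k' l' : M n) (r q s : M n') :
  Tspan m k l = Tspan m' k' l' ->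
  slice_equiv p m k l r q s -> slice_equiv p m' k' l' r q s.
Proof. by move=> eqT; rewrite /slice_equiv /It eqT. Qed.

Lemma unit_triple_sets n (A B C : {set 'I_n}) :
  A != B -> A != C -> B != C -> unit_triple (u A) (u B) (u C).
Proof.
move=> AB AC BC; split; [by exists A|by exists B|by exists C|].
by rewrite /= !inE !(inj_eq (@unit_prod_inj R n)) negb_or AB AC BC.
Qed.

(** The parities of the cardinalities fix the squares, so both triples are frames for the same
    family of signs. *)
Lemma slice_equiv_independent3 n n' (A B C : {set 'I_n}) (A' B' C' : {set 'I_n'}) :
  independent3 A B C -> independent3 A' B' C' -> odd #|A| = odd #|A'| ->
  odd #|B| = odd #|B'| -> odd #|C| = odd #|C'| ->
  slice_equiv p (u A) (u B) (u C) (u A') (u B') (u C').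
Proof.
move=> ind ind' oA oB oC; have fg := unit_frame3 (R := R) ind.
pose h (i : 'I_3) := u (nth finset.set0 [:: A'; B'; C'] i).
have fh : frame (fun i : 'I_3 =>
    (-1) ^+ nth false [:: odd #|A|; odd #|B|; odd #|C|] i) (@real_part R n') h.
  by rewrite oA oB oC; apply: unit_frame3.
apply: (slice_equiv_frame p2 fg fh).
- exact: (frame_span_gen fg ord0).
- exact: (frame_span_gen fg (lift ord0 ord0)).
- exact: (frame_span_gen fg ord_max).
have hA : frame_map _ _ _ h (u A) = u A' := frame_map_gen fg h ord0.
have hB : frame_map _ _ _ h (u B) = u B' := frame_map_gen fg h (lift ord0 ord0).
have hC : frame_map _ _ _ h (u C) = u C' := frame_map_gen fg h ord_max.
by rewrite image_Tspan /= hA hB hC.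
Qed.

Section Rank2.
Context {n n' : nat} {A B : {set 'I_n}} {A' B' : {set 'I_n'}}.
Hypothesis (A0 : A != finset.set0) (B0 : B != finset.set0) (AB : A != B).
Hypothesis (A0' : A' != finset.set0) (B0' : B' != finset.set0) (AB' : A' != B').
Hypothesis (oA : odd #|A| = odd #|A'|) (oB : odd #|B| = odd #|B'|).

Let fg := unit_frame2 (R := R) A0 B0 AB.
Let h (i : 'I_2) := u (nth finset.set0 [:: A'; B'] i).

Let fh : frame (fun i : 'I_2 => (-1) ^+ nth false [:: odd #|A|; odd #|B|] i)
  (@real_part R n') h.
Proof. by rewrite oA oB; apply: unit_frame2. Qed.

Let hA : frame_map _ _ _ h (u A) = u A' := frame_map_gen fg h ord0.
Let hB : frame_map _ _ _ h (u B) = u B' := frame_map_gen fg h ord_max.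

Lemma slice_equiv_one :
  slice_equiv p (u finset.set0) (u A) (u B) (u finset.set0) (u A') (u B').
Proof.
apply: (slice_equiv_frame p2 fg fh).
- by rewrite unit_prod0; apply: (frame_span1 fg).
- exact: (frame_span_gen fg ord0).
- exact: (frame_span_gen fg ord_max).
by rewrite image_Tspan /= hA hB !unit_prod0 (frame_map1 fg).
Qed.

Lemma slice_equiv_symdiff :
  slice_equiv p (u A) (u B) (u (symdiff A B)) (u A') (u B') (u (symdiff A' B')).
Proof.
have [e abE] := unit_prodM (R := R) A B.
have [e' abE'] := unit_prodM (R := R) A' B'.
have cE : u (symdiff A B) = (-1) ^+ e *: (u A * u B).
  by rewrite abE scalerA -expr2 sqrr_sign scale1r.
have DA := frame_span_gen fg ord0; have DB := frame_span_gen fg ord_max.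
have [_ hh _] := fh.
apply: (slice_equiv_frame p2 fg fh) => //.
  by rewrite cE; apply: (subspaceZ frame_span_subspace); apply: (frame_spanM fg).
(* A product of two units is a unit up to sign, and the signs on the two sides may differ; the span
   absorbs the discrepancy. *)
rewrite image_Tspan -(Tspan_sign (u A') (u B') _ (e (+) e')) signr_addb -scalerA -abE'.
by rewrite cE /= linearZ /= (frame_mapM fg hh DA DB) hA hB.
Qed.

End Rank2.

End Slices.

(** * Slices of units of square 1 as octahedra, and the affine map between them *)

Section Octahedra.
Context {R : realType} {p : nat}.
Hypothesis p2 : (2 <= p)%N.
Local Notation M := (multicomplex R).
Local Notation u S := (unit_prod R S).

Definition comb n (m k l : M n) (x y z : R) : M n := x *: m + y *: k + z *: l.

Lemma comb_linear n (m k l : M n) c x y z x' y' z' :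
  comb m k l (c * x + x') (c * y + y') (c * z + z') =
  c *: comb m k l x y z + comb m k l x' y' z'.
Proof.
rewrite /comb !scalerDl !scalerDr !scalerA [RHS]addrACA; congr (_ + _).
by rewrite addrACA.
Qed.

(** A character fixes 1 and gives the other two units arbitrary independent signs. *)
Lemma bounded_orbit_comb2 n (A B : {set 'I_n}) x y z :
  A != finset.set0 -> B != finset.set0 -> A != B ->
  ~~ odd #|A| -> ~~ odd #|B| ->
  bounded_orbit p (comb (u finset.set0) (u A) (u B) x y z) <->
  forall e1 e2 : bool, real_bounded p (x + (-1) ^+ e1 * y + (-1) ^+ e2 * z).
Proof.
move=> A0 B0 AB eA eB; pose g (i : 'I_2) := u (nth finset.set0 [:: A; B] i).
have fg : frame (fun=> 1) (@real_part R n) g.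
  have := unit_frame2 (R := R) A0 B0 AB.
  rewrite (negbTE eA) (negbTE eB) (_ : (fun _ : 'I_2 => _) = fun=> 1) //.
  by apply/funext => -[[|[|i]]].
have gA : u A = g ord0 by [].
have gB : u B = g ord_max by [].
have chiE E : character (g := g) E (comb (u finset.set0) (u A) (u B) x y z) =
    x + (-1) ^+ (ord0 \in E) * y + (-1) ^+ (ord_max \in E) * z.
  rewrite /comb unit_prod0 /character !linearD !linearZ /= (frame_map1 fg).
  rewrite gA gB !(frame_map_gen fg) /GRing.scale /= mulr1.
  by rewrite [y * _]mulrC [z * _]mulrC.
have Dc : frame_span (fun=> 1) (@real_part R n) g
    (comb (u finset.set0) (u A) (u B) x y z).
  have subD := @frame_span_subspace _ _ (fun=> 1) _ (@real_part R n) g.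
  rewrite /comb unit_prod0.
  apply: (subspaceD subD); [apply: (subspaceD subD)|]; apply: (subspaceZ subD).
  - exact: (frame_span1 fg).
  - exact: (frame_span_gen fg ord0).
  - exact: (frame_span_gen fg ord_max).
apply: iff_trans (bounded_orbit_characters (p := p) fg Dc) _; split=> [H e1 e2|H E].
  by have := H [set i : 'I_2 | nth false [:: e1; e2] i]%SET; rewrite chiE !inE.
by rewrite chiE.
Qed.

Lemma bounded_orbit_comb3 n (A B C : {set 'I_n}) x y z :
  independent3 A B C -> ~~ odd #|A| -> ~~ odd #|B| -> ~~ odd #|C| ->
  bounded_orbit p (comb (u A) (u B) (u C) x y z) <->
  forall e0 e1 e2 : bool,
    real_bounded p ((-1) ^+ e0 * x + (-1) ^+ e1 * y + (-1) ^+ e2 * z).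
Proof.
move=> ind eA eB eC; pose g (i : 'I_3) := u (nth finset.set0 [:: A; B; C] i).
have fg : frame (fun=> 1) (@real_part R n) g.
  have := unit_frame3 (R := R) ind.
  rewrite (negbTE eA) (negbTE eB) (negbTE eC).
  rewrite (_ : (fun _ : 'I_3 => _) = fun=> 1) //.
  by apply/funext => -[[|[|[|i]]]].
pose o1 : 'I_3 := lift ord0 ord0.
have gA : u A = g ord0 by [].
have gB : u B = g o1 by [].
have gC : u C = g ord_max by [].
have chiE E : character (g := g) E (comb (u A) (u B) (u C) x y z) =
    (-1) ^+ (ord0 \in E) * x + (-1) ^+ (o1 \in E) * y +
    (-1) ^+ (ord_max \in E) * z.
  rewrite /comb /character !linearD !linearZ /=.
  rewrite gA gB gC !(frame_map_gen fg) /GRing.scale /=.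
  by rewrite [x * _]mulrC [y * _]mulrC [z * _]mulrC.
have Dc : frame_span (fun=> 1) (@real_part R n) g (comb (u A) (u B) (u C) x y z).
  have subD := @frame_span_subspace _ _ (fun=> 1) _ (@real_part R n) g.
  apply: (subspaceD subD); [apply: (subspaceD subD)|]; apply: (subspaceZ subD).
  - exact: (frame_span_gen fg ord0).
  - exact: (frame_span_gen fg o1).
  - exact: (frame_span_gen fg ord_max).
apply: iff_trans (bounded_orbit_characters (p := p) fg Dc) _; split=> [H e0 e1 e2|H E].
  by have := H [set i : 'I_3 | nth false [:: e0; e1; e2] i]%SET; rewrite chiE !inE.
by rewrite chiE.
Qed.

(* Both sides say that the point lies in an octahedron: the left one is centred
   at ((b - a) / 2, 0, 0) with radius (a + b) / 2, the right one is centred at 0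
   with radius min a b. *)
Lemma octahedron_scaling (a b s x y z : R) :
  0 < a -> 0 < b -> 0 < s -> s * ((a + b) / 2) = Num.min a b ->
  (forall e1 e2 : bool, - a <= x + (-1) ^+ e1 * y + (-1) ^+ e2 * z <= b) <->
  (forall e0 e1 e2 : bool, - a <= (-1) ^+ e0 * (s * (x - (b - a) / 2)) +
     (-1) ^+ e1 * (s * y) + (-1) ^+ e2 * (s * z) <= b).
Proof.
move=> a0 b0 s0 sE.
have scale w : (s * w <= Num.min a b) = (w <= (a + b) / 2).
  by rewrite -sE ler_pM2l.
have min_le w : (w <= a) && (w <= b) = (w <= Num.min a b) by rewrite le_min.
split=> [H e0 e1 e2|H e1 e2].
  have K (f e e' : bool) : s * ((-1) ^+ f * (x - (b - a) / 2) +
      (-1) ^+ e * y + (-1) ^+ e' * z) <= Num.min a b.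
    rewrite scale; have /andP[] := H e e'; have /andP[] := H (~~ e) (~~ e').
    by case: f; case: e; case: e'; rewrite /= !(expr0, expr1); lra.
  have := K e0 e1 e2; have := K (~~ e0) (~~ e1) (~~ e2).
  rewrite -!min_le; case: e0; case: e1; case: e2;
    by rewrite /= !(expr0, expr1) => /andP[? ?] /andP[? ?]; apply/andP; split; lra.
have K (f e e' : bool) : (-1) ^+ f * (x - (b - a) / 2) +
    (-1) ^+ e * y + (-1) ^+ e' * z <= (a + b) / 2.
  rewrite -scale -min_le.
  have /andP[] := H f e e'; have /andP[] := H (~~ f) (~~ e) (~~ e').
  by case: f; case: e; case: e'; rewrite /= !(expr0, expr1) => *; apply/andP; split; lra.
have := K false e1 e2; have := K true (~~ e1) (~~ e2).
by case: e1; case: e2; rewrite /= !(expr0, expr1) => ? ?; apply/andP; split; lra.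
Qed.

Lemma real_part_comb n (A B C S : {set 'I_n}) x y z : ~~ odd #|S| ->
  real_part (comb (u A) (u B) (u C) x y z * u S) =
  (A == S)%:R * x + (B == S)%:R * y + (C == S)%:R * z.
Proof.
move=> evS; rewrite /comb !mulrDl -!scalerAl !linearD !linearZ /=.
rewrite !real_part_unit2 -!(signr_odd _ #|_|).
by do 3![case: eqVneq => [->|_]]; rewrite ?(negbTE evS) ?expr0 ?mulr1 ?mul1r
  ?mulr0 ?mul0r.
Qed.

Lemma affine_image_slice n n' (A' B' : {set 'I_n}) (A B C : {set 'I_n'}) :
  A' != finset.set0 -> B' != finset.set0 -> A' != B' ->
  ~~ odd #|A'| -> ~~ odd #|B'| ->
  independent3 A B C -> ~~ odd #|A| -> ~~ odd #|B| -> ~~ odd #|C| ->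
  exists f : M n -> M n',
    affine_bij (Tspan (u finset.set0) (u A') (u B')) (Tspan (u A) (u B) (u C)) f /\
    f @` slice p (u finset.set0) (u A') (u B') = slice p (u A) (u B) (u C).
Proof.
move=> A0' B0' AB' eA' eB' ind eA eB eC.
have [a [b [a0 b0 rb]]] := real_bounded_interval (R := R) p2.
have ab0 : 0 < (a + b) / 2 by lra.
(* The ratio of the radii of the two octahedra; [x0] below is the offset of the first centre along
   the unit 1. *)
pose s := Num.min a b / ((a + b) / 2).
have s0 : 0 < s by rewrite divr_gt0 // lt_min a0.
have sE : s * ((a + b) / 2) = Num.min a b by rewrite divfK // gt_eqF.
have sN0 : s != 0 by rewrite gt_eqF.
pose x0 := (b - a) / 2.
(* Since the units involved have square 1, [real_part] of a product with such a unit reads off the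
   coordinate without a sign, and it is defined on the whole of M(n). *)
pose f (v : M n) : M n' :=
  comb (u A) (u B) (u C) (s * (real_part (v * u finset.set0) - x0))
    (s * real_part (v * u A')) (s * real_part (v * u B')).
have e0 : ~~ odd #|(finset.set0 : {set 'I_n})| by rewrite cards0.
have fE x y z : f (comb (u finset.set0) (u A') (u B') x y z) =
    comb (u A) (u B) (u C) (s * (x - x0)) (s * y) (s * z).
  rewrite /f !real_part_comb // !eqxx ![finset.set0 == _]eq_sym.
  rewrite (negbTE A0') (negbTE B0') (negbTE AB') eq_sym (negbTE AB').
  by rewrite !(mul1r, mul0r, addr0, add0r).
have [/and5P[A0 B0 C0 AB /and3P[AC BC _]]] := ind.
have scaleK x : s * (x / s) = x by rewrite mulrCA divff // mulr1.
exists f; split; first split.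
- split=> [_ /TspanP[x [y [z ->]]]|v w|_ /TspanP[x [y [z ->]]]].
  + by rewrite -/(comb _ _ _ _ _ _) fE; apply/TspanP; do 3 eexists.
  + rewrite !inE => /TspanP[x [y [z ->]]] /TspanP[x' [y' [z' ->]]].
    rewrite -!/(comb _ _ _ _ _ _) !fE => E.
    have := congr1 (fun w => real_part (w * u A)) E.
    have := congr1 (fun w => real_part (w * u B)) E.
    have := congr1 (fun w => real_part (w * u C)) E.
    rewrite !real_part_comb // !eqxx ![B == A]eq_sym ![C == A]eq_sym ![C == B]eq_sym.
    rewrite (negbTE AB) (negbTE AC) (negbTE BC) !(mul1r, mul0r, addr0, add0r).
    by move=> /(mulfI sN0) -> /(mulfI sN0) -> /(mulfI sN0) /(addIr _) ->.
  exists (comb (u finset.set0) (u A') (u B') (x / s + x0) (y / s) (z / s)).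
    by apply/TspanP; do 3 eexists.
  by rewrite fE addrK !scaleK.
- exists (fun v => comb (u A) (u B) (u C) (s * real_part (v * u finset.set0))
    (s * real_part (v * u A')) (s * real_part (v * u B'))), (- (s * x0) *: u A).
  split=> [c v w _ _|v _].
    by rewrite -comb_linear !mulrDl -!scalerAl !linearP /= !mulrDr ![s * (c * _)]mulrCA.
  rewrite /f /comb mulrBr scalerDl scaleNr.
  by rewrite -!addrA; congr (_ + _); rewrite addrC -addrA.
apply/seteqP; split=> [_ [v [/TspanP[x [y [z ->]]] bv] <-]|v [/TspanP[x [y [z ->]]] bv]].
  rewrite -/(comb _ _ _ _ _ _) fE; split; first by apply/TspanP; do 3 eexists.
  apply/(bounded_orbit_comb3 _ _ _ ind eA eB eC) => i j k; apply/rb; move: i j k.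
  apply/octahedron_scaling => // i j; apply/rb; move: i j.
  exact/(bounded_orbit_comb2 x y z A0' B0' AB' eA' eB').
exists (comb (u finset.set0) (u A') (u B') (x / s + x0) (y / s) (z / s)); last first.
  by rewrite fE addrK !scaleK.
split; first by apply/TspanP; do 3 eexists.
apply/(bounded_orbit_comb2 _ _ _ A0' B0' AB' eA' eB') => i j; apply/rb; move: i j.
apply/(octahedron_scaling (x / s + x0) (y / s) (z / s) a0 b0 s0 sE) => i j k.
rewrite addrK !scaleK; apply/rb; move: i j k.
exact/(bounded_orbit_comb3 x y z ind eA eB eC).
Qed.

End Octahedra.

(** * Choice of the tricomplex and quadricomplex units, and the case analysis *)

Section Reduction.
Context {R : realType} {p : nat}.
Hypothesis p2 : (2 <= p)%N.
Local Notation M := (multicomplex R).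
Local Notation u S := (unit_prod R S).

Definition tricomplex_up_to_affine n (m k l : M n) : Prop :=
  exists ir iq is_ : M 3,
    unit_triple ir iq is_ /\
    (slice_equiv p m k l ir iq is_ \/
     exists it iu iv : M 4,
       [/\ unit_triple it iu iv,
           slice_equiv p m k l it iu iv &
           exists f : M 3 -> M 4,
             affine_bij (Tspan ir iq is_) (Tspan it iu iv) f /\
             f @` slice p ir iq is_ = slice p it iu iv]).

(** The relation ~ depends on a triple through its span only, so the units may be permuted. *)
Lemma tricomplex_up_to_affine_Tspan n (m k l m' k' l' : M n) :
  [:: m; k; l] =i [:: m'; k'; l'] ->
  tricomplex_up_to_affine m k l -> tricomplex_up_to_affine m' k' l'.
Proof.
move=> /eq_span eqT [r [q [s [rqs H]]]]; exists r, q, s; split=> //.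
case: H => [eqv|[t [v [w [tvw eqv aff]]]]].
  by left; apply: (slice_equiv_Tspan eqT).
by right; exists t, v, w; split=> //; apply: (slice_equiv_Tspan eqT).
Qed.

Lemma set_neq (T : finType) (x : T) (A B : {set T}) :
  (x \in A) != (x \in B) -> A != B.
Proof. by apply: contraNneq => ->. Qed.

Local Notation o0 := ord0.
Local Notation o1 := (lift ord0 ord0).
Local Notation o2 := (lift ord0 (lift ord0 ord0)).
Local Notation o3 := (lift ord0 (lift ord0 (lift ord0 ord0))).

Lemma tricomplex_pair (ea eb : bool) : exists A B : {set 'I_3},
  [/\ A != finset.set0, B != finset.set0, A != B, odd #|A| = ea & odd #|B| = eb].
Proof.
case: ea; case: eb.
- exists [set o0]%SET, [set o1]%SET; split; rewrite ?cards1 //.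
  + by apply: (@set_neq _ o0); rewrite !inE.
  + by apply: (@set_neq _ o1); rewrite !inE.
  + by apply: (@set_neq _ o0); rewrite !inE.
- exists [set o0]%SET, [set o0; o1]%SET; split; rewrite ?cards1 ?cards2 //.
  + by apply: (@set_neq _ o0); rewrite !inE.
  + by apply: (@set_neq _ o1); rewrite !inE.
  + by apply: (@set_neq _ o1); rewrite !inE.
- exists [set o0; o1]%SET, [set o0]%SET; split; rewrite ?cards1 ?cards2 //.
  + by apply: (@set_neq _ o1); rewrite !inE.
  + by apply: (@set_neq _ o0); rewrite !inE.
  + by apply: (@set_neq _ o1); rewrite !inE.
exists [set o0; o1]%SET, [set o0; o2]%SET; split; rewrite ?cards2 //.
- by apply: (@set_neq _ o1); rewrite !inE.
- by apply: (@set_neq _ o2); rewrite !inE.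
- by apply: (@set_neq _ o1); rewrite !inE.
Qed.

(** Among the three sets, [o1] lies in the second one only and [o2] in the third one only, so they
    are independent. One odd set must occur: the subsets of even size of a three-element set have
    dimension 2 over the field with two elements. *)
Lemma tricomplex_odd_triple (eb ec : bool) : exists A B C : {set 'I_3},
  [/\ independent3 A B C, odd #|A|, odd #|B| = eb & odd #|C| = ec].
Proof.
exists [set o0]%SET, (if eb then [set o1] else [set o0; o1])%SET,
  (if ec then [set o2] else [set o0; o2])%SET.
split; [|by rewrite cards1|by case: eb; rewrite ?cards1 ?cards2
  |by case: ec; rewrite ?cards1 ?cards2].
apply/and5P; split.
- by apply: (@set_neq _ o0); rewrite !inE.
- by apply: (@set_neq _ o1); case: eb; rewrite !inE.
- by apply: (@set_neq _ o2); case: ec; rewrite !inE.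
- by apply: (@set_neq _ o1); case: eb; rewrite !inE.
apply/and3P; split.
- by apply: (@set_neq _ o2); case: ec; rewrite !inE.
- by apply: (@set_neq _ o1); case: eb; case: ec; rewrite !inE.
by apply: (@set_neq _ o1); case: eb; case: ec; rewrite !inE.
Qed.

Lemma quadricomplex_even_triple :
  @independent3 4 [set o0; o1]%SET [set o0; o2]%SET [set o0; o3]%SET.
Proof.
apply/and5P; split.
- by apply: (@set_neq _ o1); rewrite !inE.
- by apply: (@set_neq _ o2); rewrite !inE.
- by apply: (@set_neq _ o3); rewrite !inE.
- by apply: (@set_neq _ o1); rewrite !inE.
apply/and3P; split.
- by apply: (@set_neq _ o1); rewrite !inE.
- by apply: (@set_neq _ o2); rewrite !inE.
by apply: (@set_neq _ o1); rewrite !inE.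
Qed.

Lemma reduce_one n (A B : {set 'I_n}) :
  A != finset.set0 -> B != finset.set0 -> A != B ->
  tricomplex_up_to_affine (u finset.set0) (u A) (u B).
Proof.
move=> A0 B0 AB.
have [A' [B' [A0' B0' AB' oA oB]]] := tricomplex_pair (odd #|A|) (odd #|B|).
exists (u finset.set0), (u A'), (u B'); split; last by left; apply: slice_equiv_one.
by apply: unit_triple_sets => //; rewrite eq_sym.
Qed.

Lemma reduce_symdiff n (A B : {set 'I_n}) :
  A != finset.set0 -> B != finset.set0 -> A != B ->
  tricomplex_up_to_affine (u A) (u B) (u (symdiff A B)).
Proof.
move=> A0 B0 AB.
have [A' [B' [A0' B0' AB' oA oB]]] := tricomplex_pair (odd #|A|) (odd #|B|).
exists (u A'), (u B'), (u (symdiff A' B')).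
split; last by left; apply: slice_equiv_symdiff.
apply: unit_triple_sets => //.
  case/finset.set0Pn: B0' => i iB; apply: (@set_neq _ i).
  by rewrite inE iB; case: (i \in A').
case/finset.set0Pn: A0' => i iA; apply: (@set_neq _ i).
by rewrite inE iA; case: (i \in B').
Qed.

Lemma reduce_odd n (A B C : {set 'I_n}) : independent3 A B C -> odd #|A| ->
  tricomplex_up_to_affine (u A) (u B) (u C).
Proof.
move=> ind oA.
have [A' [B' [C' [ind' oA' oB oC]]]] := tricomplex_odd_triple (odd #|B|) (odd #|C|).
have [/and5P[_ _ _ AB /and3P[AC BC _]]] := ind'.
exists (u A'), (u B'), (u C'); split; first exact: unit_triple_sets.
by left; apply: slice_equiv_independent3; rewrite ?oA.
Qed.

Lemma reduce_even n (A B C : {set 'I_n}) : independent3 A B C ->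
  ~~ odd #|A| -> ~~ odd #|B| -> ~~ odd #|C| ->
  tricomplex_up_to_affine (u A) (u B) (u C).
Proof.
move=> ind eA eB eC.
have [A' [B' [A0' B0' AB' oA' oB']]] := tricomplex_pair false false.
exists (u finset.set0), (u A'), (u B').
split; first by apply: unit_triple_sets => //; rewrite eq_sym.
(* Even subsets of a four-element set have dimension 3, so the relation ~ is obtained in I(4); the
   tricomplex slice of 1 and two units of square 1 enters through the affine map. *)
right; have ind' := quadricomplex_even_triple.
have [/and5P[_ _ _ AB /and3P[AC BC _]]] := ind'.
exists (u [set o0; o1]%SET), (u [set o0; o2]%SET), (u [set o0; o3]%SET).
split; first exact: unit_triple_sets.
  apply: slice_equiv_independent3 => //; rewrite cards2 //=; exact/negbTE.
by apply: affine_image_slice; rewrite ?oA' ?oB' ?cards2.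
Qed.

Lemma symdiff_swap n (A B C : {set 'I_n}) :
  (symdiff A B == C) = (symdiff A C == B).
Proof.
by apply/eqP/eqP => <-; apply/setP => i; rewrite !inE addbA addbb.
Qed.

Lemma independent3_swap n (A B C : {set 'I_n}) :
  independent3 A B C -> independent3 B A C.
Proof.
move=> /and5P[A0 B0 C0 AB /and3P[AC BC ABC]].
apply/and5P; split=> //; first by rewrite eq_sym.
apply/and3P; split=> //.
by rewrite (_ : symdiff B A = symdiff A B) //; apply/setP => i; rewrite !inE addbC.
Qed.

Lemma independent3_swap_last n (A B C : {set 'I_n}) :
  independent3 A B C -> independent3 A C B.
Proof.
move=> /and5P[A0 B0 C0 AB /and3P[AC BC ABC]].
apply/and5P; split=> //; apply/and3P.
by split; rewrite // 1?eq_sym // eq_sym -symdiff_swap.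
Qed.

Lemma reduce n (A B C : {set 'I_n}) : A != B -> A != C -> B != C ->
  tricomplex_up_to_affine (u A) (u B) (u C).
Proof.
move=> AB AC BC.
have [A0|A0] := eqVneq A finset.set0.
  by rewrite A0 in AB AC *; apply: reduce_one; rewrite // eq_sym.
have [B0|B0] := eqVneq B finset.set0.
  rewrite B0 in AB BC *.
  apply: (@tricomplex_up_to_affine_Tspan _ (u finset.set0) (u A) (u C)).
    by move=> x; rewrite !inE orbCA.
  by apply: reduce_one; rewrite // eq_sym.
have [C0|C0] := eqVneq C finset.set0.
  rewrite C0 in AC BC *.
  apply: (@tricomplex_up_to_affine_Tspan _ (u finset.set0) (u A) (u B)).
    by move=> x; rewrite !inE orbC orbA.
  exact: reduce_one.
have [<-|ABC] := eqVneq (symdiff A B) C; first exact: reduce_symdiff.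
have ind : independent3 A B C by apply/and5P; split=> //; apply/and3P.
(* For an independent triple, any unit of square -1 is moved to the front; without one, the
   exceptional case remains. *)
have [oA|eA] := boolP (odd #|A|); first exact: reduce_odd.
have [oB|eB] := boolP (odd #|B|).
  apply: (@tricomplex_up_to_affine_Tspan _ (u B) (u A) (u C)).
    by move=> x; rewrite !inE orbCA.
  exact: reduce_odd (independent3_swap ind) oB.
have [oC|eC] := boolP (odd #|C|); last exact: reduce_even.
apply: (@tricomplex_up_to_affine_Tspan _ (u C) (u A) (u B)).
  by move=> x; rewrite !inE orbC orbA.
exact: reduce_odd (independent3_swap (independent3_swap_last ind)) oC.
Qed.

End Reduction.

Theorem theorem5 (R : realType) (n p : nat) (hn : (2 <= n)%N) (hp : (2 <= p)%N)
    (im ik il : multicomplex R n) (hT1 : unit_triple im ik il) :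
  exists ir iq is_ : multicomplex R 3,
    unit_triple ir iq is_ /\
    (slice_equiv p im ik il ir iq is_ \/
     exists it iu iv : multicomplex R 4,
       [/\ unit_triple it iu iv,
           slice_equiv p im ik il it iu iv &
           exists f : multicomplex R 3 -> multicomplex R 4,
             affine_bij (Tspan ir iq is_) (Tspan it iu iv) f /\
             f @` slice p ir iq is_ = slice p it iu iv]).
Proof.
case: hT1 => -[A _ <-] [B _ <-] [C _ <-].
rewrite /= !inE negb_or => /and3P[/andP[AB AC] BC _].
by apply: (reduce hp); [move: AB | move: AC | move: BC]; apply: contra_neq => ->.
Qed.
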